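(* Let $\mathfrak U$ be an ensemble of unitaries on an $n$-qubit system $S$ containing a $k$-qubit logical system $L$, right-invariant under Pauli matrices, and let $\mathcal N$ be a noise channel on $S$ with complementary channel $\hat{\mathcal N}_{S\to E}$. Then for any state $\psi_{LR}$, with reduced state $\rho_R=\mathrm{tr}_L(\psi_{LR})$, $$\mathbb E_{U_S\sim\mathfrak U}\min_{\tau_E}\big\Vert\hat{\mathcal N}_{S\to E}[U_S(\psi_{LR}\otimes|0\rangle\langle0|_{S\setminus L})U_S^\dagger]-\tau_E\otimes\rho_R\big\Vert_1\le2\,\mathbb E_{U_S\sim\mathfrak U}\,\epsilon_{\mathrm{Choi}},$$ where $\epsilon_{\mathrm{Choi}}$ is the Choi error of the unitary encoding $U_S$ under the noise channel $\mathcal N$ and the minimum is over quantum states $\tau_E$ of $E$.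
   Context: Right-invariance: for every Pauli gate $P$ and every unitary $U\in\mathfrak U$, the probability of drawing $U$ equals the probability of drawing $UP$: $p_{\mathfrak U}(U)=p_{\mathfrak U}(UP)$. Complementary channel: if $\mathcal N(\rho)=\sum_iK_i\rho K_i^\dagger$, then $\hat{\mathcal N}_{S\to E}(\rho)=\sum_{ij}\mathrm{tr}(K_i\rho K_j^\dagger)|i\rangle\langle j|$ (equivalently, tracing out the system instead of the environment in a Stinespring dilation of $\mathcal N$). Choi error: for the encoding $\mathcal E(\rho)=U_S(\rho_L\otimes|0\rangle\langle0|_{S\setminus L})U_S^\dagger$ (ancillas in the all-zero state), $\epsilon_{\mathrm{Choi}}=\min_{\mathcal D}P(\hat\phi_{LR},[(\mathcal D\circ\mathcal N\circ\mathcal E)_L\otimes I_R](\hat\phi_{LR}))$ over decoding channels $\mathcal D$ to $L$, with $\hat\phi_{LR}$ the maximally entangled state, $P=\sqrt{1-F^2}$ and $F(\rho,\sigma)=\Vert\sqrt\rho\sqrt\sigma\Vert_1$. $R$ is a reference system; all maps act trivially on $R$. *)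

(* Defs.v *)
From HB Require Import structures.
From mathcomp Require Import all_boot all_order all_algebra.
From mathcomp Require Import complex mxtens.
From mathcomp Require Import all_classical all_reals all_analysis.

Set Implicit Arguments.
Unset Strict Implicit.
Unset Printing Implicit Defensive.

Import Order.TTheory GRing.Theory Num.Theory.
Import numFieldNormedType.Exports.

Local Open Scope classical_set_scope.
Local Open Scope ring_scope.
Local Open Scope sesquilinear_scope.
Local Open Scope complex_scope.

Section Operators.
Variable R : realType.
Local Notation C := (R[i]).

(* Over [R[i]], [0 <= z] says that z is real and nonnegative, so this implies
   that A is Hermitian. *)
Definition psdmx (n : nat) (A : 'M[C]_n) : Prop :=
  forall v : 'cV[C]_n, 0 <= (v^t* *m A *m v) 0 0.

Definition density (n : nat) (A : 'M[C]_n) : Prop := psdmx A /\ \tr A = 1.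

(* The functional calculus of the square root: by [orthomx_spectralP], a normal
   matrix A is [invmx P *m diag_mx D *m P] with P := spectralmx A unitary and
   D := spectral_diag A.  Only meaningful on positive semidefinite A. *)
Definition sqrtmx (n : nat) (A : 'M[C]_n) : 'M[C]_n :=
  invmx (spectralmx A) *m diag_mx (map_mx sqrtC (spectral_diag A))
    *m spectralmx A.

(* The trace below is a nonnegative real of R[i]; [Re] only casts it to R. *)
Definition trnorm (n : nat) (A : 'M[C]_n) : R :=
  complex.Re (\tr (sqrtmx (A^t* *m A))).

Definition fidelity (n : nat) (rho sigma : 'M[C]_n) : R :=
  trnorm (sqrtmx rho *m sqrtmx sigma).

Definition purified_distance (n : nat) (rho sigma : 'M[C]_n) : R :=
  Num.sqrt (1 - fidelity rho sigma ^+ 2).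

(* Operators on a composite system A (x) B of dimensions a and b are matrices
   of size a * b, indexed by [mxtens_index (s, i)] as for [tensmx].
   [mxblockR X i j] is (1 (x) <i|) X (1 (x) |j>). *)
Definition mxblockR (a r : nat) (X : 'M[C]_(a * r)) (i j : 'I_r) : 'M[C]_a :=
  \matrix_(s, t) X (mxtens_index (s, i)) (mxtens_index (t, j)).

(* Phi (x) id on a reference system of dimension r, for linear Phi. *)
Definition extid (a b r : nat) (Phi : 'M[C]_a -> 'M[C]_b) (X : 'M[C]_(a * r)) :
    'M[C]_(b * r) :=
  \sum_(i < r) \sum_(j < r) Phi (mxblockR X i j) *t delta_mx i j.

Definition ptrace1 (a r : nat) (X : 'M[C]_(a * r)) : 'M[C]_r :=
  \matrix_(i, j) \tr (mxblockR X i j).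

Definition channel (a b : nat) (Phi : {linear 'M[C]_a -> 'M[C]_b}) : Prop :=
  (forall X : 'M[C]_a, \tr (Phi X) = \tr X) /\
  (forall (r : nat) (X : 'M[C]_(a * r)), psdmx X -> psdmx (extid Phi X)).

Definition kraus_rep (a b e : nat) (K : 'I_e -> 'M[C]_(b, a))
    (Phi : 'M[C]_a -> 'M[C]_b) : Prop :=
  forall rho : 'M[C]_a, Phi rho = \sum_(i < e) K i *m rho *m (K i)^t*.

Definition compl_channel (a b e : nat) (K : 'I_e -> 'M[C]_(b, a))
    (rho : 'M[C]_a) : 'M[C]_e :=
  \matrix_(i, j) \tr (K i *m rho *m (K j)^t*).

(* |phi><phi| for |phi> = d^(-1/2) \sum_i |i>|i>. *)
Definition maxent (d : nat) : 'M[C]_(d * d) :=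
  d%:R^-1 *: \sum_(i < d) \sum_(j < d) delta_mx i j *t delta_mx i j.

End Operators.

(* A register of qubits labelled by the finite type I has the computational
   basis {ffun I -> bool}; matrix indices enumerate it through
   [enum_rank]/[enum_val]. *)
Definition qbasis (I : finType) : finType := {ffun I -> bool}.
Definition qdim (I : finType) : nat := #|qbasis I|.
Definition qbits (I : finType) (s : 'I_(qdim I)) : {ffun I -> bool} :=
  enum_val s.
Definition qindex (I : finType) (x : {ffun I -> bool}) : 'I_(qdim I) :=
  enum_rank (x : qbasis I).

Inductive pauli := PauliI | PauliX | PauliY | PauliZ.

Section Qubits.
Variables (R : realType) (n : nat).
Local Notation C := (R[i]).

(* The entry <x| p |y>, with false, true standing for 0, 1. *)
Definition pauli1 (p : pauli) (x y : bool) : C :=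
  match p with
  | PauliI => (x == y)%:R
  | PauliX => (x != y)%:R
  | PauliY => if x == y then 0 else if x then 'i else - 'i
  | PauliZ => if x == y then (-1) ^+ x else 0
  end.

(* The tensor product over q of the single-qubit gates p q. *)
Definition paulimx (p : 'I_n -> pauli) : 'M[C]_(qdim 'I_n) :=
  \matrix_(s, t) \prod_(q < n) pauli1 (p q) (qbits s q) (qbits t q).

Variable L : {set 'I_n}.

Definition inL : finType := {q : 'I_n | q \in L}.
Definition notL : finType := {q : 'I_n | q \notin L}.

(* The unitary identification of the space of L (x) (S \ L) with that of S:
   |x|_L> (x) |x|_(S\L)> is sent to |x>. *)
Definition regmx : 'M[C]_(qdim 'I_n, qdim inL * qdim notL) :=
  \matrix_(s, t)
    (([ffun q : inL => qbits s (val q)]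
        == qbits (mxtens_unindex t).1) &&
     ([ffun q : notL => qbits s (val q)]
        == qbits (mxtens_unindex t).2))%:R.

Definition zero_state : 'M[C]_(qdim notL) :=
  let z := qindex [ffun _ : notL => false] in delta_mx z z.

Definition encoding (U : 'M[C]_(qdim 'I_n)) (rho : 'M[C]_(qdim inL)) :
    'M[C]_(qdim 'I_n) :=
  U *m (regmx *m (rho *t zero_state) *m regmx^t*) *m U^t*.

(* The minima over decoders and over states of E are attained, by compactness;
   they are written as infima of sets of reals. *)
Definition choi_error
    (N : 'M[C]_(qdim 'I_n) -> 'M[C]_(qdim 'I_n)) (U : 'M[C]_(qdim 'I_n)) : R :=
  let phi := maxent R (qdim inL) in
  inf [set purified_distance phi (extid (D \o N \o encoding U) phi) |
        D in [set D : {linear 'M[C]_(qdim 'I_n) -> 'M[C]_(qdim inL)} |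
               channel D]].

Definition env_deviation (e r : nat) (K : 'I_e -> 'M[C]_(qdim 'I_n))
    (psi : 'M[C]_(qdim inL * r)) (U : 'M[C]_(qdim 'I_n)) : R :=
  inf [set trnorm (extid (compl_channel K) (extid (encoding U) psi)
                     - tau *t ptrace1 psi) |
        tau in [set tau : 'M[C]_e | density tau]].

End Qubits.

Section Ensembles.
Variables (R : realType).
Local Notation C := (R[i]).

(* Square complex matrices with their Borel sigma-algebra; [C^o] carries the
   topology of the modulus. *)
Definition mxBorel (d : nat) := g_sigma_algebraType (@open 'M[C^o]_d).

Definition unitaries (d : nat) : set (mxBorel d) :=
  [set U : 'M[C]_d | U \is unitarymx].

(* An ensemble of unitaries is a Borel probability measure carried by the
   unitary group. *)
Definition unitary_ensemble (d : nat) (mu : probability (mxBorel d) R) : Prop :=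
  mu (@unitaries d) = 1%E.

Definition pauli_right_invariant (n : nat)
    (mu : probability (mxBorel (qdim 'I_n)) R) : Prop :=
  forall (p : 'I_n -> pauli) (A : set (mxBorel (qdim 'I_n))), measurable A ->
    mu A = mu ((fun U : 'M[C]_(qdim 'I_n) => U *m paulimx R p) @` A).

Definition ensemble_mean (d : nat) (mu : probability (mxBorel d) R)
    (f : 'M[C]_d -> R) : \bar R :=
  (\int[mu]_(U in @unitaries d) (f U)%:E)%E.

End Ensembles.

(* Main.v *)
(* For the decoder D of an encoding U, let c_ki be the normalized trace of D_k K_i V,
   where D_k and K_i are Kraus operators of D and N and V is the isometry
   U(. (x) |0>): the entanglement fidelity of D is f = sum |c_ki|^2.  Write
   psi = sum_m |psi_m><psi_m|.  For a logical Pauli gate P, the vectors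
   (D_k K_i V P) |psi_m> and chi_ki P |psi_m>, with chi = c / sqrt f, purify the
   environment-reference state of the gate UP and tau (x) rho_R, where tau is the
   reduced state of chi and does not depend on P.  By the Pauli twirl
   sum_P P^* G P ~ tr(G) 1, the average over P of their overlaps is sqrt f,
   whatever psi is.  As trace distances are attained by contractions M, and
   Re(<a|M|a> - <b|M|b>) <= |a - b| |a + b|, the P-average of the trace distances
   is at most 2 sqrt(1 - f), which is twice the purified distance achieved by D.
   Right-invariance of the ensemble then removes the average over P. *)
Require Import Defs.
From HB Require Import structures.
From mathcomp Require Import all_boot all_order all_algebra.
From mathcomp Require Import complex mxtens ring lra.
From mathcomp Require Import all_classical all_reals all_analysis measurable_realfun.

Set Implicit Arguments.
Unset Strict Implicit.
Unset Printing Implicit Defensive.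

Import Order.TTheory GRing.Theory Num.Theory.
Import numFieldNormedType.Exports.

Local Open Scope classical_set_scope.
Local Open Scope ring_scope.
Local Open Scope sesquilinear_scope.

(** * Positive matrices and contractions *)

Section MatrixAnalysis.
Variable C : numClosedFieldType.

Lemma adjmxM m n p (A : 'M[C]_(m, n)) (B : 'M[C]_(n, p)) :
  (A *m B)^t* = B^t* *m A^t*.
Proof. by rewrite trmx_mul map_mxM. Qed.

Lemma adjmxD m n (A B : 'M[C]_(m, n)) : (A + B)^t* = A^t* + B^t*.
Proof. by rewrite linearD map_mxD. Qed.

Lemma adjmxZ m n (c : C) (A : 'M[C]_(m, n)) : (c *: A)^t* = c^* *: A^t*.
Proof. by rewrite linearZ map_mxZ. Qed.

Lemma adjmxB m n (A B : 'M[C]_(m, n)) : (A - B)^t* = A^t* - B^t*.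
Proof. by rewrite linearB map_mxB. Qed.

(** The predicate [psdmx] over a general closed field; at [R[i]] the two are convertible. *)
Definition psd n (A : 'M[C]_n) := forall v : 'cV[C]_n, 0 <= (v^t* *m A *m v) 0 0.

Lemma psd_gram m n (Q : 'M[C]_(m, n)) : psd (Q *m Q^t*).
Proof.
move=> v; rewrite !mulmxA -[X in 0 <= X]/((_ *m _) 0 0).
have -> : v^t* *m Q *m Q^t* *m v = (Q^t* *m v)^t* *m (Q^t* *m v).
  by rewrite adjmxM trmxCK !mulmxA.
by rewrite mxE sumr_ge0 // => i _; rewrite !mxE mulrC mul_conjC_ge0.
Qed.

(** Polarization: the form at [u + v] gives antisymmetry in [u] and [v]; replacing [v] by ['i *: v]
    then makes twice each off-diagonal value vanish. *)
Lemma sesqui_eq0 n (B : 'M[C]_n) :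
  (forall v : 'cV_n, v^t* *m B *m v = 0) -> B = 0.
Proof.
move=> B0.
have exp (u v : 'cV_n) : v^t* *m B *m u = - (u^t* *m B *m v).
  have := B0 (u + v); rewrite adjmxD mulmxDl mulmxDl 2!mulmxDr !B0 addr0 add0r addrC.
  by move=> /eqP; rewrite addr_eq0 => /eqP.
have pol (u v : 'cV_n) : u^t* *m B *m v = 0.
  have := exp u ('i *: v); rewrite adjmxZ conjCi -!scalemxAl -scalemxAr (exp u v).
  rewrite scaleNr scalerN opprK => /eqP; rewrite -addr_eq0 -mulr2n -scaler_nat.
  by rewrite !scaler_eq0 pnatr_eq0 (negPf (neq0Ci _)) /= => /eqP.
apply/matrixP=> i j; have := pol (delta_mx i 0) (delta_mx j 0).
move/matrixP/(_ 0 0).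
have -> : (delta_mx i 0)^t* = delta_mx 0 i :> 'rV[C]_n.
  by rewrite trmx_delta map_delta_mx.
by rewrite -rowE -colE !mxE.
Qed.

(** The values of the form are real, so the form of [A - A^t*] is identically zero. *)
Lemma psd_adj n (A : 'M[C]_n) : psd A -> A^t* = A.
Proof.
move=> Apsd; apply/esym/eqP; rewrite -subr_eq0; apply/eqP/sesqui_eq0 => v.
rewrite mulmxBr mulmxBl; apply/matrixP=> i j; rewrite !ord1 !mxE /=.
have -> : \sum_j0 (v^t* *m A) 0 j0 * v j0 0 = (v^t* *m A *m v) 0 0 by rewrite mxE.
have -> : \sum_j0 (v^t* *m A^t*) 0 j0 * v j0 0 = (v^t* *m A *m v)^t* 0 0.
  by rewrite !adjmxM trmxCK mulmxA [RHS]mxE.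
by rewrite [X in _ - X]mxE [X in _ - X^*]mxE conj_Creal ?subrr // ger0_real //.
Qed.

Lemma psd_spectral n (A : 'M[C]_n) : psd A ->
  [/\ A = (spectralmx A)^t* *m diag_mx (spectral_diag A) *m spectralmx A,
      spectralmx A *m (spectralmx A)^t* = 1%:M,
      (spectralmx A)^t* *m spectralmx A = 1%:M &
      forall i, 0 <= spectral_diag A 0 i].
Proof.
move=> Apsd; have Aadj := psd_adj Apsd.
have An : A \is normalmx by apply/normalmxP; rewrite Aadj.
have U := spectral_unitarymx A; have /unitarymxP PP := U.
have PP' : (spectralmx A)^t* *m spectralmx A = 1%:M by exact: mulmx1C.
have E : A = (spectralmx A)^t* *m diag_mx (spectral_diag A) *m spectralmx A.
  by rewrite -invmx_unitary // -(orthomx_spectralP An).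
split=> // i; set P := spectralmx A in PP PP' E *.
(* The form evaluated at the i-th eigenvector is the i-th eigenvalue. *)
have := Apsd (P^t* *m delta_mx i 0); rewrite [X in _ *m X *m _]E adjmxM trmxCK !mulmxA.
rewrite -[_ *m P *m P^t*]mulmxA PP mulmx1 -[_ *m P *m P^t*]mulmxA PP mulmx1.
by rewrite trmx_delta map_delta_mx -rowE -colE !mxE eqxx mulr1n.
Qed.

Definition psdsqrt n (A : 'M[C]_n) : 'M[C]_n :=
  (spectralmx A)^t* *m diag_mx (map_mx sqrtC (spectral_diag A)) *m spectralmx A.

Lemma diag_mx_adj n (d : 'rV[C]_n) : (diag_mx d)^t* = diag_mx (map_mx Num.conj d).
Proof. by rewrite tr_diag_mx map_diag_mx. Qed.

Lemma psdsqrtP n (A : 'M[C]_n) : psd A ->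
  (psdsqrt A)^t* = psdsqrt A /\ psdsqrt A *m psdsqrt A = A.
Proof.
move=> /psd_spectral; rewrite /psdsqrt.
move: (spectralmx A) (spectral_diag A) => P D [AE PP PP' D0]; split.
  rewrite !adjmxM trmxCK diag_mx_adj mulmxA.
  rewrite (_ : map_mx _ _ = map_mx sqrtC D) //.
  by apply/matrixP=> i j; rewrite !mxE ord1 conj_Creal // ger0_real // sqrtC_ge0.
rewrite [RHS]AE !mulmxA -[_ *m P *m P^t*]mulmxA PP mulmx1.
rewrite -[_ *m diag_mx _ *m diag_mx _]mulmxA mulmx_diag.
rewrite (_ : (\row_i _) = D) //; apply/rowP=> i; rewrite !mxE -expr2 sqrtCK //.
Qed.

(* [M M^* <= 1]. *)
Definition contractive n (M : 'M[C]_n) := forall x : 'cV[C]_n,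
  ((M^t* *m x)^t* *m (M^t* *m x)) 0 0 <= (x^t* *m x) 0 0.

Lemma dotmx_cE n (x y : 'cV[C]_n) : (x^t* *m y) 0 0 = \sum_i (x i 0)^* * y i 0.
Proof. by rewrite mxE; apply: eq_bigr => i _; rewrite !mxE. Qed.

Lemma psd_gramC m n (Q : 'M[C]_(m, n)) : psd (Q^t* *m Q).
Proof. by rewrite -{2}(trmxCK Q); exact: psd_gram. Qed.

Lemma tr_psdsqrt n (A : 'M[C]_n) : \tr (psdsqrt A) = \sum_i sqrtC (spectral_diag A 0 i).
Proof.
rewrite /psdsqrt mxtrace_mulC mulmxA.
have /unitarymxP -> := spectral_unitarymx A; rewrite mul1mx mxtrace_diag.
by apply: eq_bigr => i _; rewrite mxE.
Qed.

Lemma tr_psdsqrt_ge0 n (A : 'M[C]_n) : psd A -> 0 <= \tr (psdsqrt A).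
Proof.
move=> /psd_spectral[_ _ _ D0]; rewrite tr_psdsqrt.
by apply: sumr_ge0 => i _; rewrite sqrtC_ge0.
Qed.

(* M = |A|^+ A^*, with |A|^+ the pseudo-inverse (here 0^-1 = 0) of |A|. *)
Lemma tr_absmx_dual n (A : 'M[C]_n) :
  exists2 M : 'M[C]_n, contractive M & \tr (psdsqrt (A^t* *m A)) = \tr (M *m A).
Proof.
rewrite tr_psdsqrt; have := psd_spectral (psd_gramC A).
move: (spectralmx _) (spectral_diag _) => P D [AE PP PP' D0].
pose s := map_mx (fun z => (sqrtC z)^-1) D.
have sadj : (diag_mx s)^t* = diag_mx s.
  rewrite diag_mx_adj; congr diag_mx; apply/rowP => i.
  by rewrite !mxE conj_Creal // ger0_real // invr_ge0 sqrtC_ge0.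
have [S SE] : exists S, S = P^t* *m diag_mx s *m P by exists (P^t* *m diag_mx s *m P).
have Sadj : S^t* = S by rewrite SE !adjmxM trmxCK sadj mulmxA.
exists (S *m A^t*).
- move=> x; have -> : (S *m A^t*)^t* = A *m S by rewrite adjmxM trmxCK Sadj.
  have -> : (A *m S *m x)^t* *m (A *m S *m x)
    = (P *m x)^t* *m diag_mx (\row_i (s 0 i * D 0 i * s 0 i)) *m (P *m x).
    rewrite !adjmxM Sadj !mulmxA -[_ *m A^t* *m A]mulmxA AE SE !mulmxA.
    rewrite -[_ *m P *m P^t*]mulmxA PP mulmx1 -[_ *m P *m P^t*]mulmxA PP mulmx1.
    rewrite -[_ *m diag_mx s *m diag_mx D]mulmxA mulmx_diag.
    rewrite -[_ *m diag_mx _ *m diag_mx s]mulmxA mulmx_diag.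
    by rewrite (_ : (\row_j _) = \row_i (s 0 i * D 0 i * s 0 i)) //;
      apply/rowP=> i; rewrite !mxE.
  have -> : x^t* *m x = (P *m x)^t* *m (P *m x).
    by rewrite adjmxM mulmxA -[_ *m _ *m P]mulmxA PP' mulmx1.
  set y := P *m x; rewrite -mulmxA !dotmx_cE; apply: ler_sum => i _.
  rewrite mul_diag_mx !mxE mulrCA -[leRHS]mul1r.
  apply: ler_wpM2r; first by rewrite mulrC mul_conjC_ge0.
  have [->|Dn0] := eqVneq (D 0 i) 0; first by rewrite mulr0 mul0r ler01.
  rewrite mulrAC -invfM -expr2 sqrtCK mulVf //.
- rewrite -mulmxA AE SE !mulmxA -[_ *m P *m P^t*]mulmxA PP mulmx1.
  rewrite mxtrace_mulC !mulmxA PP mul1mx mulmx_diag mxtrace_diag.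
  apply: eq_bigr => i _; rewrite !mxE.
  have [->|Dn0] := eqVneq (D 0 i) 0; first by rewrite sqrtC0 mulr0.
  by rewrite -{3}[D 0 i]sqrtCK expr2 mulKf // sqrtC_eq0.
Qed.

Lemma conj_dotmx n (x y : 'cV[C]_n) : ((x^t* *m y) 0 0)^* = (y^t* *m x) 0 0.
Proof.
by rewrite !dotmx_cE rmorph_sum; apply: eq_bigr => i _; rewrite rmorphM /= conjCK mulrC.
Qed.

Lemma dotmx_ge0 n (x : 'cV[C]_n) : 0 <= (x^t* *m x) 0 0.
Proof. by rewrite dotmx_cE sumr_ge0 // => i _; rewrite mulrC mul_conjC_ge0. Qed.

(** Expansion of [|t x - y|^2 >= 0]. Keeping the weight [t] free lets such bounds be summed first
    and optimised once at the end, in place of Cauchy-Schwarz. *)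
Lemma Re_dotmx_le n (t : C) (x y : 'cV[C]_n) : 0 < t ->
  'Re ((x^t* *m y) 0 0) <= (t * (x^t* *m x) 0 0 + t^-1 * (y^t* *m y) 0 0) / 2.
Proof.
move=> t0; have tn0 : t != 0 by rewrite gt_eqF.
have treal : t^* = t by rewrite conj_Creal // gtr0_real.
have := dotmx_ge0 (t *: x - y).
rewrite adjmxB adjmxZ treal mulmxBl !mulmxBr -!scalemxAl -!scalemxAr.
move: (conj_dotmx x y).
move: (x^t* *m x) (x^t* *m y) (y^t* *m x) (y^t* *m y) => xx xy yx yy yxE.
rewrite !mxE -yxE ReE.
move: (xx 0 0) (xy 0 0) (yy 0 0) => X Z Y H.
rewrite ler_pM2r ?invr_gt0 ?ltr0n // -subr_ge0.
rewrite -(pmulr_rge0 _ t0); congr (0 <= _): H; field.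
by [].
Qed.

Lemma Re_contractive_le n (M : 'M[C]_n) (a b : 'cV[C]_n) (t : C) :
  contractive M -> 0 < t ->
  'Re ((a^t* *m M *m a) 0 0 - (b^t* *m M *m b) 0 0) <=
    (t * ((a - b)^t* *m (a - b)) 0 0 + t^-1 * ((a + b)^t* *m (a + b)) 0 0) / 2.
Proof.
move=> Mc t0.
(* Polarized difference: half of [<a-b|M|a+b> + <a+b|M|a-b>]. *)
have E : (a^t* *m M *m a) 0 0 - (b^t* *m M *m b) 0 0 =
   (((M^t* *m (a - b))^t* *m (a + b)) 0 0 + ((M^t* *m (a + b))^t* *m (a - b)) 0 0) / 2.
  rewrite !adjmxM trmxCK adjmxB adjmxD !mulmxDl !mulmxDr !mulmxN !mulNmx.
  move: (a^t* *m M *m a) (a^t* *m M *m b) (b^t* *m M *m a) (b^t* *m M *m b) => aa ab ba bb.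
  by rewrite !mxE; field.
rewrite E; set B := (X in _ <= X); set u := (_^t* *m _) 0 0; set v := (_^t* *m (a - b)) 0 0.
have t0' : 0 < t^-1 by rewrite invr_gt0.
have H1 : 'Re u <= B.
  apply: le_trans (Re_dotmx_le _ _ t0) _; rewrite ler_pM2r ?invr_gt0 ?ltr0n // lerD2r.
  by rewrite ler_pM2l // Mc.
have H2 : 'Re v <= B.
  (* The roles of sum and difference are exchanged here, so the weight is inverted to reach the same
     bound [B]. *)
  apply: le_trans (Re_dotmx_le _ _ t0') _; rewrite ler_pM2r ?invr_gt0 ?ltr0n //.
  by rewrite invrK addrC lerD2l ler_pM2l // Mc.
rewrite ReMr ?rpredV ?realn // raddfD /= ler_pdivrMr ?ltr0n // mulr_natr mulr2n.
exact: lerD.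
Qed.

(* The state of X when the vector [\sum_x |Z x> (x) |x>] of A (x) B (x) X is
   reduced to X; here [Z x] is a p * m matrix seen as a vector of A (x) B. *)
Definition grammx N p m (Z : 'I_N -> 'M[C]_(p, m)) : 'M[C]_N :=
  \matrix_(x, y) \tr (Z x *m (Z y)^t*).

(** A sum of rank-one terms, one for each matrix entry [(u, v)]: tracing out the other systems turns
    a purification into an ensemble of vectors. *)
Lemma grammxE N p m (Z : 'I_N -> 'M[C]_(p, m)) :
  grammx Z = \sum_(u < p) \sum_(v < m)
    (\col_x Z x u v) *m (\col_x Z x u v)^t*.
Proof.
apply/matrixP => x y; rewrite mxE summxE; apply: eq_bigr => u _.
rewrite summxE mxE; apply: eq_bigr => v _.
by rewrite !mxE big_ord1 !mxE.
Qed.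

Lemma tr_outer n (M : 'M[C]_n) (a : 'cV[C]_n) :
  \tr (M *m (a *m a^t*)) = (a^t* *m M *m a) 0 0.
Proof. by rewrite mulmxA mxtrace_mulC mulmxA trace_mx11. Qed.

Lemma conj_mxtrace n (A : 'M[C]_n) : (\tr A)^* = \tr (A^t*).
Proof. by rewrite -[in LHS]mxtrace_tr trace_map_mx. Qed.

Lemma mxtrace_gram_dotmx N p m (A B : 'I_N -> 'M[C]_(p, m)) :
  \sum_x \tr ((A x)^t* *m B x) =
    \sum_(u < p) \sum_(v < m) ((\col_x A x u v)^t* *m (\col_x B x u v)) 0 0.
Proof.
have -> : \sum_x \tr ((A x)^t* *m B x) = \sum_x \sum_(u < p) \sum_(v < m) (A x u v)^* * B x u v.
  apply: eq_bigr => x _; rewrite /mxtrace exchange_big /=; apply: eq_bigr => v _.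
  by rewrite mxE; apply: eq_bigr => u _; rewrite !mxE.
rewrite exchange_big; apply: eq_bigr => u _; rewrite exchange_big; apply: eq_bigr => v _.
by rewrite dotmx_cE; apply: eq_bigr => x _; rewrite !mxE.
Qed.

Lemma Re_tr_grammx_le N p m (M : 'M[C]_N) (A B : 'I_N -> 'M[C]_(p, m)) (t : C) :
  contractive M -> 0 < t ->
  'Re (\tr (M *m (grammx A - grammx B))) <=
    (t * \sum_x \tr ((A x - B x)^t* *m (A x - B x)) +
     t^-1 * \sum_x \tr ((A x + B x)^t* *m (A x + B x))) / 2.
Proof.
move=> Mc t0.
have trE (Z : 'I_N -> 'M[C]_(p, m)) : \tr (M *m grammx Z) =
    \sum_(u < p) \sum_(v < m) ((\col_x Z x u v)^t* *m M *m (\col_x Z x u v)) 0 0.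
  rewrite grammxE mulmx_sumr raddf_sum; apply: eq_bigr => u _.
  by rewrite /= mulmx_sumr raddf_sum /=; apply: eq_bigr => v _; rewrite tr_outer.
rewrite mulmxBr raddfB /= !trE -sumrB raddf_sum.
rewrite !mxtrace_gram_dotmx !mulr_sumr -big_split /= mulr_suml.
apply: ler_sum => u _; rewrite -sumrB raddf_sum !mulr_sumr -big_split /= mulr_suml.
apply: ler_sum => v _.
have := Re_contractive_le (\col_x A x u v) (\col_x B x u v) Mc t0; congr (_ <= _).
rewrite (_ : _ - _ = \col_x (A x - B x) u v); last by apply/colP => x; rewrite !mxE.
by rewrite (_ : _ + _ = \col_x (A x + B x) u v) //; apply/colP => x; rewrite !mxE.
Qed.

(** Both families have squared norm [s] and real overlap [s * c], so their difference and sum have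
    squared norms [2s(1 - c)] and [2s(1 + c)]. *)
Lemma sum_Re_tr_grammx_le (I : finType) N p m (M : I -> 'M[C]_N)
    (A B : I -> 'I_N -> 'M[C]_(p, m)) (s c t : C) :
    (forall i, contractive (M i)) -> 0 < t -> (s * c)^* = s * c ->
    \sum_i \sum_x \tr ((A i x)^t* *m A i x) = s ->
    \sum_i \sum_x \tr ((B i x)^t* *m B i x) = s ->
    \sum_i \sum_x \tr ((B i x)^t* *m A i x) = s * c ->
  'Re (\sum_i \tr (M i *m (grammx (A i) - grammx (B i)))) <=
    s * (t * (1 - c) + t^-1 * (1 + c)).
Proof.
move=> Mc t0 scR sA sB sBA.
have sAB : \sum_i \sum_x \tr ((A i x)^t* *m B i x) = s * c.
  rewrite -scR -sBA rmorph_sum; apply: eq_bigr => i _.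
  rewrite rmorph_sum; apply: eq_bigr => x _ /=.
  by rewrite conj_mxtrace adjmxM trmxCK.
rewrite raddf_sum; apply: le_trans (ler_sum _ (fun i _ => Re_tr_grammx_le _ _ (Mc i) t0)) _.
rewrite -mulr_suml big_split /= -!mulr_sumr.
have -> : \sum_i \sum_x \tr ((A i x - B i x)^t* *m (A i x - B i x)) = s + s - (s * c + s * c).
  transitivity (\sum_i \sum_x \tr ((A i x)^t* *m A i x) + \sum_i \sum_x \tr ((B i x)^t* *m B i x)
    - (\sum_i \sum_x \tr ((A i x)^t* *m B i x) + \sum_i \sum_x \tr ((B i x)^t* *m A i x))).
    rewrite -!big_split -sumrB /=; apply: eq_bigr => i _.
    rewrite -!big_split -sumrB /=; apply: eq_bigr => x _.
    by rewrite adjmxB mulmxBl !mulmxBr !raddfB /=; ring.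
  by rewrite sA sB sAB sBA.
have -> : \sum_i \sum_x \tr ((A i x + B i x)^t* *m (A i x + B i x)) = s + s + (s * c + s * c).
  transitivity (\sum_i \sum_x \tr ((A i x)^t* *m A i x) + \sum_i \sum_x \tr ((B i x)^t* *m B i x)
    + (\sum_i \sum_x \tr ((A i x)^t* *m B i x) + \sum_i \sum_x \tr ((B i x)^t* *m A i x))).
    rewrite -!big_split /=; apply: eq_bigr => i _.
    rewrite -!big_split /=; apply: eq_bigr => x _.
    by rewrite adjmxD mulmxDl !mulmxDr !raddfD /=; ring.
  by rewrite sA sB sAB sBA.
have tn0 : t != 0 by rewrite gt_eqF.
by rewrite le_eqVlt; apply/orP; left; apply/eqP; field.
Qed.

Lemma psd_factor n (A : 'M[C]_n) : psd A -> exists Q : 'M[C]_n, A = Q *m Q^t*.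
Proof. by move=> /psdsqrtP[Sadj SS]; exists (psdsqrt A); rewrite Sadj SS. Qed.

(* The case [c = 0] is why the type must be inhabited. *)
Lemma unit_vector_aligned (I : finType) (i0 : I) (c : I -> C) :
  exists2 x : I -> C, \sum_i x i * (x i)^* = 1 &
    \sum_i (x i)^* * c i = sqrtC (\sum_i c i * (c i)^*).
Proof.
set F := sqrtC _.
have F2 : F ^+ 2 = \sum_i c i * (c i)^* by rewrite sqrtCK.
have F0 : 0 <= F by rewrite sqrtC_ge0; apply: sumr_ge0 => i _; exact: mul_conjC_ge0.
have FR : F^* = F by rewrite conj_Creal // ger0_real.
have [Fz|Fn0] := eqVneq F 0.
  have c0 i : c i = 0.
    have /eqP := F2; rewrite Fz expr0n /= eq_sym psumr_eq0; last first.
      by move=> ? _; exact: mul_conjC_ge0.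
    by move=> /allP/(_ i (mem_index_enum i))/implyP/(_ isT); rewrite mul_conjC_eq0 => /eqP.
  exists (fun i => (i == i0)%:R).
    rewrite (bigD1 i0) //= eqxx mul1r conjC1 big1 ?addr0 // => i /negPf ->.
    by rewrite mul0r.
  by rewrite Fz big1 // => i _; rewrite c0 mulr0.
exists (fun i => c i / F).
  under eq_bigr do rewrite rmorphM fmorphV /= FR mulrACA.
  by rewrite -mulr_suml -F2 -invfM -expr2 divff // expf_neq0.
under eq_bigr do rewrite rmorphM fmorphV /= FR mulrAC [_^* * _]mulrC.
by rewrite -mulr_suml -F2 expr2 mulfK.
Qed.

(** * Twirling the purifications *)

(** The uniform average of [P^t* *m G *m P] is [tr(G)/d] times the identity, stated with
    denominators cleared. *)
Definition twirl_to_trace (I : finType) d (P : I -> 'M[C]_d) := forall G : 'M[C]_d,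
  d%:R *: \sum_f (P f)^t* *m G *m P f = (#|I|%:R * \tr G)%:M.

Lemma sum_mxtens (a b : nat) (F : 'I_a -> 'I_b -> C) :
  \sum_(x < a * b) F (mxtens_unindex x).1 (mxtens_unindex x).2 = \sum_i \sum_j F i j.
Proof.
rewrite pair_bigA (reindex (@mxtens_index a b)).
  by apply: eq_bigr => ij _; rewrite mxtens_indexK.
by exists (@mxtens_unindex a b) => ? _; rewrite ?mxtens_indexK ?mxtens_unindexK.
Qed.

Lemma sum_pairE (I J : finType) (F : I * J -> C) : \sum_z F z = \sum_i \sum_j F (i, j).
Proof. by rewrite pair_bigA; apply: eq_bigr => -[]. Qed.

Section TwirlBound.
Variables (I : finType) (d p e r m q : nat).
Variables (D : 'I_q -> 'M[C]_(d, p)) (W : 'I_e -> 'M[C]_(p, d)) (P : I -> 'M[C]_d).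
Variable Y : 'I_r -> 'M[C]_(d, m).
Hypothesis D1 : \sum_k (D k)^t* *m D k = 1%:M.
Hypothesis W1 : \sum_i (W i)^t* *m W i = 1%:M.
Hypothesis P1 : forall f, (P f)^t* *m P f = 1%:M.
Hypothesis PT : twirl_to_trace P.
Hypothesis d0 : d != 0%N.
Hypothesis Y1 : \sum_x \tr ((Y x)^t* *m Y x) = 1.
Variable chi : 'I_q * 'I_e -> C.
Hypothesis chi1 : \sum_z chi z * (chi z)^* = 1.
Let c z := \tr (D z.1 *m W z.2) / d%:R.

(* Purifications of the output state and of [tau (x) rho_R]: [k] and [j] number
   the Kraus operators of the decoder and of the noise, [y] the reference basis,
   and column m of [Y y] is <y|psi_m>, where psi = \sum_m |psi_m><psi_m|. *)
Definition output_family (fk : I * 'I_q) (x : 'I_(e * r)) :=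
  D fk.2 *m W (mxtens_unindex x).1 *m P fk.1 *m Y (mxtens_unindex x).2.
Definition target_family (fk : I * 'I_q) (x : 'I_(e * r)) :=
  chi (fk.2, (mxtens_unindex x).1) *: (P fk.1 *m Y (mxtens_unindex x).2).

Lemma sum_family (F : I -> 'I_q -> 'I_e -> 'I_r -> C) :
  \sum_(i : I * 'I_q) \sum_(x < e * r) F i.1 i.2 (mxtens_unindex x).1 (mxtens_unindex x).2 =
  \sum_f \sum_k \sum_j \sum_y F f k j y.
Proof. by rewrite sum_pairE; do 2![apply: eq_bigr => ? _]; rewrite -sum_mxtens. Qed.

(** The completeness relations remove [D], then [W], then [P f]; what is left is the norm of [Y], so
    every [f] contributes 1. *)
Lemma sum_norm_output : \sum_i \sum_x \tr ((output_family i x)^t* *m output_family i x) = #|I|%:R.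
Proof.
rewrite (sum_family (fun f k j y =>
  \tr ((D k *m W j *m P f *m Y y)^t* *m (D k *m W j *m P f *m Y y)))).
rewrite -sum1_card natr_sum; apply: eq_bigr => f _.
rewrite exchange_big /= -Y1.
transitivity (\sum_(j < e) \sum_(y < r)
    \tr ((Y y)^t* *m (P f)^t* *m ((W j)^t* *m (\sum_k (D k)^t* *m D k) *m W j) *m P f *m Y y)).
  apply: eq_bigr => j _; rewrite exchange_big /=; apply: eq_bigr => y _.
  rewrite -raddf_sum !(mulmx_suml, mulmx_sumr) /=; congr (\tr _).
  by apply: eq_bigr => k _; rewrite !adjmxM !mulmxA.
rewrite exchange_big /=; apply: eq_bigr => y _.
transitivity (\tr ((Y y)^t* *m ((P f)^t* *m (\sum_j (W j)^t* *m W j) *m P f) *m Y y)).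
  rewrite -raddf_sum !(mulmx_suml, mulmx_sumr) /=; congr (\tr _).
  by apply: eq_bigr => k _; rewrite D1 mulmx1 !mulmxA.
by rewrite W1 mulmx1 P1 mulmx1.
Qed.

Lemma sum_norm_target : \sum_i \sum_x \tr ((target_family i x)^t* *m target_family i x) = #|I|%:R.
Proof.
have BE f k j y : \tr ((chi (k, j) *: (P f *m Y y))^t* *m (chi (k, j) *: (P f *m Y y)))
   = chi (k, j) * (chi (k, j))^* * \tr ((Y y)^t* *m Y y).
  rewrite adjmxZ adjmxM -scalemxAl -scalemxAr scalerA !mulmxA -[_ *m _ *m P f]mulmxA P1 mulmx1.
  by rewrite mxtraceZ [_^* * _]mulrC.
rewrite (sum_family (fun f k j y =>
  \tr ((chi (k, j) *: (P f *m Y y))^t* *m (chi (k, j) *: (P f *m Y y))))).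
rewrite -sum1_card natr_sum; apply: eq_bigr => f _.
rewrite -chi1 sum_pairE.
apply: eq_bigr => k _; apply: eq_bigr => j _.
by under eq_bigr do rewrite BE; rewrite -mulr_sumr Y1 mulr1.
Qed.

(** Here the twirl acts: the sum over [f] replaces [D k *m W j] by a scalar, so the input enters
    only through the norm of [Y], whatever the state is. *)
Lemma sum_inner_target_output : \sum_i \sum_x \tr ((target_family i x)^t* *m output_family i x) =
  #|I|%:R * \sum_z (chi z)^* * c z.
Proof.
rewrite (sum_family (fun f k j y =>
  \tr ((chi (k, j) *: (P f *m Y y))^t* *m (D k *m W j *m P f *m Y y)))).
rewrite sum_pairE mulr_sumr.
rewrite exchange_big /=; apply: eq_bigr => k _.
rewrite exchange_big mulr_sumr /=; apply: eq_bigr => j _.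
rewrite exchange_big /= -[RHS]mulr1 -[X in _ = _ * X]Y1 mulr_sumr; apply: eq_bigr => y _.
transitivity ((chi (k, j))^* * \tr ((Y y)^t* *m (\sum_f (P f)^t* *m (D k *m W j) *m P f) *m Y y)).
  rewrite !(mulmx_suml, mulmx_sumr) raddf_sum mulr_sumr; apply: eq_bigr => f _ /=.
  by rewrite adjmxZ adjmxM -scalemxAl mxtraceZ !mulmxA.
have dn0 : d%:R != 0 :> C by rewrite pnatr_eq0.
have -> : \sum_f (P f)^t* *m (D k *m W j) *m P f = (#|I|%:R * c (k, j))%:M.
  apply: (scalerI dn0); rewrite PT scale_scalar_mx /c /=; congr (_%:M).
  by field.
by rewrite mul_mx_scalar -scalemxAl mxtraceZ; ring.
Qed.

(** The contraction may depend on the gate [f] but is shared by all [k], because only the sum over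
    [k] gives the states to be compared. *)
Lemma sum_Re_tr_twirl_le (M : I -> 'M[C]_(e * r)) (t : C) :
  (forall f, contractive (M f)) -> 0 < t ->
  (\sum_z (chi z)^* * c z)^* = \sum_z (chi z)^* * c z ->
  'Re (\sum_f \tr (M f *m
      (\sum_k (grammx (output_family (f, k)) - grammx (target_family (f, k)))))) <=
    #|I|%:R * (t * (1 - \sum_z (chi z)^* * c z) + t^-1 * (1 + \sum_z (chi z)^* * c z)).
Proof.
move=> Mc t0 cR.
have := @sum_Re_tr_grammx_le _ _ _ _ (fun i => M i.1) output_family target_family _ _ t
  (fun i => Mc i.1) t0 _ sum_norm_output sum_norm_target sum_inner_target_output.
rewrite rmorphM /= conjC_nat cR => /(_ erefl); congr ('Re _ <= _).
rewrite sum_pairE.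
by apply: eq_bigr => f _; rewrite mulmx_sumr raddf_sum.
Qed.

(** Summing over [k] discards the output of the decoder: [D1] removes it and leaves the
    environment-reference state of the gate [f]. *)
Lemma sum_grammx_output f x y : (\sum_k grammx (output_family (f, k))) x y =
  \tr (W (mxtens_unindex x).1 *m P f *m Y (mxtens_unindex x).2 *m
    (W (mxtens_unindex y).1 *m P f *m Y (mxtens_unindex y).2)^t*).
Proof.
rewrite summxE; set Z := W _ *m _ *m _; set Z' := W _ *m _ *m _.
transitivity (\tr ((\sum_k (D k)^t* *m D k) *m (Z *m Z'^t*))); last by rewrite D1 mul1mx.
rewrite mulmx_suml raddf_sum; apply: eq_bigr => k _ /=.
rewrite mxE /output_family /= -!(mulmxA (D k)) -/Z -/Z' adjmxM !mulmxA mxtrace_mulC.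
by rewrite !mulmxA.
Qed.

(** The unitary [P f] cancels under the trace, so the result is the same product state for every
    gate. *)
Lemma sum_grammx_target f x y : (\sum_k grammx (target_family (f, k))) x y =
  (\sum_k chi (k, (mxtens_unindex x).1) * (chi (k, (mxtens_unindex y).1))^*) *
    \tr (Y (mxtens_unindex x).2 *m (Y (mxtens_unindex y).2)^t*).
Proof.
rewrite summxE mulr_suml; apply: eq_bigr => k _; rewrite mxE /target_family /=.
rewrite adjmxZ adjmxM -scalemxAl -scalemxAr scalerA mxtraceZ; congr (_ * _).
by rewrite mxtrace_mulC !mulmxA -[_ *m _ *m P f]mulmxA P1 mulmx1 mxtrace_mulC.
Qed.

End TwirlBound.

(** * Kraus operators and entanglement fidelity *)

Lemma mx_eq1_of_trace n (A : 'M[C]_n) :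
  (forall X : 'M[C]_n, \tr (A *m X) = \tr X) -> A = 1%:M.
Proof.
move=> H; apply/matrixP => i j; have := H (delta_mx j i).
have -> : \tr (A *m delta_mx j i) = A i j.
  rewrite /mxtrace (bigD1 i) //= big1 ?addr0 => [|k ki]; rewrite !mxE.
    rewrite (bigD1 j) //= big1 ?addr0 => [|k kj]; rewrite !mxE ?eqxx ?mulr1 //.
    by rewrite (negPf kj) mulr0.
  by rewrite big1 // => l _; rewrite !mxE (negPf ki) andbF mulr0.
move=> ->; rewrite /mxtrace (bigD1 i) //= big1 ?addr0 => [|k ki]; rewrite !mxE.
  by rewrite eqxx andbT.
by rewrite (negPf ki) andbF.
Qed.

Lemma kraus_trace a b e (K : 'I_e -> 'M[C]_(b, a)) (Phi : 'M[C]_a -> 'M[C]_b) :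
  (forall X, Phi X = \sum_i K i *m X *m (K i)^t*) -> (forall X, \tr (Phi X) = \tr X) ->
  \sum_i (K i)^t* *m K i = 1%:M.
Proof.
move=> PhiE trPhi; apply: mx_eq1_of_trace => X; rewrite -[RHS]trPhi PhiE.
rewrite mulmx_suml !raddf_sum; apply: eq_bigr => i _ /=.
by rewrite [RHS]mxtrace_mulC mulmxA.
Qed.

Lemma conj_scale_delta_mx a b (A : 'M[C]_(b, a)) (x : C) s i t j :
  (A *m (x *: delta_mx i j) *m A^t*) s t = x * (A s i * (A t j)^*).
Proof.
rewrite -scalemxAr -scalemxAl mxE; congr (_ * _).
rewrite -(mul_delta_mx (0 : 'I_1)) mulmxA -colE -mulmxA -rowE.
by rewrite mxE big_ord1 !mxE.
Qed.

(** [Q *m Q^t*] is the Choi matrix; the columns of its factor, reshaped into matrices, are Kraus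
    operators. *)
Lemma kraus_of_choi a b q (Phi : {linear 'M[C]_a -> 'M[C]_b}) (Q : 'M[C]_(b * a, q)) :
  (forall s i t j, Phi (delta_mx i j) s t =
     (Q *m Q^t*) (mxtens_index (s, i)) (mxtens_index (t, j))) ->
  let D k : 'M[C]_(b, a) := \matrix_(s, i) Q (mxtens_index (s, i)) k in
  forall X, Phi X = \sum_k D k *m X *m (D k)^t*.
Proof.
move=> PhiE D X; rewrite [in LHS](matrix_sum_delta X).
apply/matrixP => s t; rewrite linear_sum !summxE.
transitivity (\sum_i \sum_j \sum_k D k s i * X i j * (D k t j)^*).
  apply: eq_bigr => i _; rewrite linear_sum summxE; apply: eq_bigr => j _.
  rewrite linearZ mxE PhiE mxE mulr_sumr; apply: eq_bigr => k _.
  by rewrite !mxE; ring.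
under eq_bigr do rewrite exchange_big; rewrite exchange_big /=; apply: eq_bigr => k _.
rewrite exchange_big mxE /=; apply: eq_bigr => j _.
by rewrite !mxE mulr_suml; apply: eq_bigr => i _; rewrite !mxE.
Qed.

Lemma adjmx_mul_eq0 m n (A : 'M[C]_(m, n)) : A^t* *m A = 0 -> A = 0.
Proof.
move=> Z; apply/matrixP => i j; move/matrixP/(_ j j): Z.
rewrite !mxE => /eqP; rewrite psumr_eq0 => [|k _]; last first.
  by rewrite !mxE mulrC mul_conjC_ge0.
move=> /allP/(_ i (mem_index_enum i))/implyP/(_ isT).
by rewrite !mxE mulrC mul_conjC_eq0 => /eqP.
Qed.

Lemma psdsqrt_pure n (v : 'cV[C]_n) : (v^t* *m v) 0 0 = 1 ->
  psdsqrt (v *m v^t*) = psdsqrt (v *m v^t*) *m v *m v^t* /\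
  ((psdsqrt (v *m v^t*) *m v)^t* *m (psdsqrt (v *m v^t*) *m v)) 0 0 = 1.
Proof.
move=> v1; have [] := psdsqrtP (psd_gram v); move: (psdsqrt _) => B Badj BB.
have vv : v^t* *m v = 1%:M by rewrite [LHS]mx11_scalar v1.
split; last by rewrite adjmxM Badj -mulmxA (mulmxA B) BB !mulmxA vv mul1mx vv mxE.
(* The root [B] vanishes on the complement of [v], since its square does. This suffices below
   without identifying [B] with the projector. *)
have Z : (B - B *m v *m v^t*)^t* *m (B - B *m v *m v^t*) = 0.
  rewrite adjmxB !adjmxM trmxCK Badj mulmxBl !mulmxBr !mulmxA BB.
  rewrite -[_ *m B *m B]mulmxA BB !mulmxA.
  by do 2!rewrite -[v *m v^t* *m v]mulmxA vv mulmx1; rewrite !subrr.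
by apply/eqP; rewrite -subr_eq0 (adjmx_mul_eq0 Z).
Qed.

(** Optimising over [t] bounds the fidelity with a pure state by the square root of [<v|sigma|v>],
    hence bounds the purified distance from below. *)
Lemma pure_fidelity_le n (v : 'cV[C]_n) (sigma M : 'M[C]_n) (t : C) :
  (v^t* *m v) 0 0 = 1 -> psd sigma -> contractive M -> 0 < t ->
  'Re (\tr (M *m (psdsqrt (v *m v^t*) *m psdsqrt sigma))) <=
    (t * (v^t* *m sigma *m v) 0 0 + t^-1) / 2.
Proof.
move=> v1 /psdsqrtP[Sadj SS] Mc t0; have [BE Bv] := psdsqrt_pure v1.
move: BE Bv; move: (psdsqrt (v *m v^t*)) => B BE Bv.
move: (psdsqrt sigma) Sadj SS => S Sadj SS.
have -> : \tr (M *m (B *m S)) = ((M^t* *m (S *m v))^t* *m (B *m v)) 0 0.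
  have -> : B *m S = (B *m v) *m (v^t* *m S) by rewrite {1}BE !mulmxA.
  by rewrite !adjmxM trmxCK Sadj -trace_mx11 (mulmxA M) mxtrace_mulC !mulmxA.
apply: le_trans (Re_dotmx_le _ _ t0) _; rewrite ler_pM2r ?invr_gt0 ?ltr0n //.
rewrite Bv mulr1 lerD2r ler_pM2l //; apply: le_trans (Mc _) _.
by rewrite adjmxM Sadj -mulmxA (mulmxA S S) SS mulmxA.
Qed.

Definition maxent_vec d : 'cV[C]_(d * d) :=
  \col_x (((mxtens_unindex x).1 == (mxtens_unindex x).2)%:R / sqrtC d%:R).

Lemma sqrtC_nat d : (sqrtC d%:R : C)^* = sqrtC d%:R.
Proof. by rewrite conj_Creal // ger0_real // sqrtC_ge0. Qed.

Lemma maxent_vec_sum d (F : 'I_(d * d) -> C) :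
  \sum_x (maxent_vec d x 0)^* * F x = \sum_i F (mxtens_index (i, i)) / sqrtC d%:R.
Proof.
rewrite (reindex (@mxtens_index d d)) /=; last first.
  by exists (@mxtens_unindex d d) => ? _; rewrite ?mxtens_indexK ?mxtens_unindexK.
rewrite sum_pairE; apply: eq_bigr => i _.
rewrite (bigD1 i) //= big1 ?addr0 => [|j ji]; rewrite !mxE mxtens_indexK /=.
  by rewrite eqxx mul1r fmorphV /= sqrtC_nat mulrC.
by rewrite eq_sym (negPf ji) mul0r conjC0 mul0r.
Qed.

Lemma maxent_vec_unit d : d != 0%N -> ((maxent_vec d)^t* *m maxent_vec d) 0 0 = 1.
Proof.
move=> d0; rewrite dotmx_cE maxent_vec_sum.
rewrite (eq_bigr (fun=> d%:R^-1)) => [|i _]; last first.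
  by rewrite !mxE mxtens_indexK eqxx mul1r -invfM -expr2 sqrtCK.
by rewrite sumr_const card_ord -[_^-1 *+ d]mulr_natl divff // pnatr_eq0.
Qed.

Lemma sesqui_sum_outer n (I : finType) (g : I -> 'cV[C]_n) (v : 'cV[C]_n) :
  (v^t* *m (\sum_z g z *m (g z)^t*) *m v) 0 0 = \sum_z (v^t* *m g z) 0 0 * ((v^t* *m g z) 0 0)^*.
Proof.
rewrite mulmx_sumr mulmx_suml summxE; apply: eq_bigr => z _.
by rewrite mulmxA -mulmxA mxE big_ord1 conj_dotmx.
Qed.

Lemma psd_sum_outer n (I : finType) (g : I -> 'cV[C]_n) : psd (\sum_z g z *m (g z)^t*).
Proof. by move=> v; rewrite sesqui_sum_outer sumr_ge0 // => z _; exact: mul_conjC_ge0. Qed.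

(** Here [sigma] is the Choi state of the map with Kraus operators [G z], and the overlap is its
    entanglement fidelity. *)
Lemma maxent_overlap d (I : finType) (G : I -> 'M[C]_d) (sigma : 'M[C]_(d * d)) :
  (forall s i t j, sigma (mxtens_index (s, i)) (mxtens_index (t, j)) =
     \sum_z d%:R^-1 * (G z s i * (G z t j)^*)) ->
  psd sigma /\ ((maxent_vec d)^t* *m sigma *m maxent_vec d) 0 0 =
     \sum_z (\tr (G z) / d%:R) * (\tr (G z) / d%:R)^*.
Proof.
move=> sE; pose g z : 'cV[C]_(d * d) :=
  \col_x (G z (mxtens_unindex x).1 (mxtens_unindex x).2 / sqrtC d%:R).
have sg : sigma = \sum_z g z *m (g z)^t*.
  apply/matrixP => x y; rewrite -(mxtens_unindexK x) -(mxtens_unindexK y).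
  case: (mxtens_unindex x) (mxtens_unindex y) => s i [t j]; rewrite sE summxE.
  apply: eq_bigr => z _; rewrite mxE big_ord1 !mxE !mxtens_indexK /=.
  by rewrite rmorphM fmorphV /= sqrtC_nat mulrACA -invfM -expr2 sqrtCK mulrC.
split; rewrite sg; first exact: psd_sum_outer.
rewrite sesqui_sum_outer; apply: eq_bigr => z _.
suff -> : ((maxent_vec d)^t* *m g z) 0 0 = \tr (G z) / d%:R by [].
rewrite dotmx_cE maxent_vec_sum mulr_suml; apply: eq_bigr => i _.
by rewrite !mxE mxtens_indexK -mulrA -invfM -expr2 sqrtCK.
Qed.

Lemma unitarymx_mulr n (A P : 'M[C]_n) :
  P \is unitarymx -> (A *m P \is unitarymx) = (A \is unitarymx).
Proof.
move=> P1; apply/idP/idP => [AP1|A1]; last exact: mul_unitarymx.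
have /unitarymxP PP := P1.
have -> : A = A *m P *m P^t* by rewrite -mulmxA PP mulmx1.
by apply: mul_unitarymx; rewrite ?trmxC_unitary.
Qed.

End MatrixAnalysis.

(** * Trace norm, channels and the twirled deviation *)

Section Reals.
Variable R : realType.

(* Optimising over [t] would be [t = sqrt (b / a)], which degenerates when [a] or [b] is 0. *)
Lemma le_sqrt_of_weighted_sum (x a b : R) : 0 <= x -> 0 <= b ->
  (forall t, 0 < t -> x <= t * a + t^-1 * b) -> x <= 2 * Num.sqrt (a * b).
Proof.
move=> x0 b0 H; case: (ltgtP a 0) => [a0|a0|a0].
(* For negative [a] this weight makes the right side at most [a], contradicting [0 <= x]. *)
- have t1 : 0 < 1 + b / (- a) by rewrite ltr_wpDr // divr_ge0 // oppr_ge0 ltW.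
  have := H _ t1; set t := 1 + _ in t1 *; rewrite leNgt => /negP[].
  have -> : t * a = a - b by rewrite /t; field; rewrite lt_eqF.
  apply: lt_le_trans x0; rewrite -addrA; apply: (le_lt_trans _ a0).
  rewrite gerDl addrC subr_le0 ler_piMl // invf_le1 //.
  by rewrite lerDl divr_ge0 // oppr_ge0 ltW.
- have [bz|bn0] := eqVneq b 0.
    rewrite bz mulr0 sqrtr0 mulr0 leNgt; apply/negP => xp.
    (* This weight yields [x <= x / 2]. *)
    have := H (x / (2 * a)); rewrite divr_gt0 ?mulr_gt0 // => /(_ isT).
    rewrite bz mulr0 addr0; have -> : x / (2 * a) * a = x / 2 by field; rewrite gt_eqF.
    lra.
  have bp : 0 < b by rewrite lt_neqAle eq_sym bn0.
  pose u := Num.sqrt a; pose v := Num.sqrt b.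
  have up : 0 < u by rewrite sqrtr_gt0.
  have vp : 0 < v by rewrite sqrtr_gt0.
  have vu : 0 < v / u by rewrite divr_gt0.
  apply: (le_trans (H _ vu)).
  rewrite (sqrtrM _ (ltW a0)) -/u -/v.
  rewrite -[X in _ * X + _](sqr_sqrtr (ltW a0)) -[X in _ + _ * X](sqr_sqrtr (ltW bp)) -/u -/v.
  rewrite le_eqVlt; apply/orP; left; apply/eqP; field.
  by rewrite !gt_eqF.
- rewrite a0 mul0r sqrtr0 mulr0 leNgt; apply/negP => xp.
  have b1 : 0 < b + 1 by rewrite ltr_wpDl.
  (* This weight yields [x <= x * b / (b + 1)], which is less than [x]. *)
  have := H ((b + 1) / x); rewrite divr_gt0 // => /(_ isT).
  rewrite a0 mulr0 add0r invf_div leNgt => /negP[].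
  by rewrite mulrAC ltr_pdivrMr // mulrDr mulr1 ltrDl.
Qed.

End Reals.

Section Bridge.
Variable R : realType.
Local Notation C := R[i].

Lemma sqrtmxE n (A : 'M[C]_n) : sqrtmx A = psdsqrt A.
Proof. by rewrite /sqrtmx invmx_unitary // spectral_unitarymx. Qed.

Lemma ge0_complexRe (z : C) : 0 <= z -> ((complex.Re z)%:C)%C = z.
Proof. by move=> z0; apply: RRe_real; exact: ger0_real. Qed.

Lemma trnormE n (A : 'M[C]_n) : ((trnorm A)%:C)%C = \tr (psdsqrt (A^t* *m A)).
Proof. by rewrite /trnorm sqrtmxE ge0_complexRe // tr_psdsqrt_ge0 //; exact: psd_gramC. Qed.

Lemma trnorm_ge0 n (A : 'M[C]_n) : 0 <= trnorm A.
Proof. by rewrite -ler0c trnormE tr_psdsqrt_ge0 //; exact: psd_gramC. Qed.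

Lemma trnorm_dual n (A : 'M[C]_n) :
  exists2 M : 'M[C]_n, contractive M & ((trnorm A)%:C)%C = \tr (M *m A).
Proof. by have [M Mc ME] := tr_absmx_dual A; exists M; rewrite // trnormE. Qed.

Lemma extidE a b r (Phi : 'M[C]_a -> 'M[C]_b) (X : 'M[C]_(a * r)) s i t j :
  extid Phi X (mxtens_index (s, i)) (mxtens_index (t, j)) = Phi (mxblockR X i j) s t.
Proof.
rewrite /extid summxE (bigD1 i) //= [X in _ + X]big1 ?addr0 => [|i' i'i];
  rewrite summxE; last first.
  by apply: big1 => j' _; rewrite tensmxE mxE eq_sym (negPf i'i) mulr0.
rewrite (bigD1 j) //= big1 ?addr0 => [|j' j'j]; rewrite tensmxE mxE.
  by rewrite !eqxx mulr1.
by rewrite [j == _]eq_sym (negPf j'j) andbF mulr0.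
Qed.

Lemma mxblockR_extid a b r (Phi : 'M[C]_a -> 'M[C]_b) (X : 'M[C]_(a * r)) i j :
  mxblockR (extid Phi X) i j = Phi (mxblockR X i j).
Proof. by apply/matrixP => s t; rewrite mxE extidE. Qed.

Lemma channel_kraus a b (Phi : {linear 'M[C]_a -> 'M[C]_b}) : channel Phi ->
  exists q (D : 'I_q -> 'M[C]_(b, a)),
    kraus_rep D Phi /\ \sum_k (D k)^t* *m D k = 1%:M.
Proof.
move=> [trPhi cpPhi].
(* The unnormalized maximally entangled vector: the blocks of its projector are the matrix units, so
   [extid Phi] sends it to the Choi matrix, which is positive. *)
pose v : 'cV[C]_(a * a) := \col_x ((mxtens_unindex x).1 == (mxtens_unindex x).2)%:R.
have blk i j : mxblockR (v *m v^t*) i j = delta_mx i j.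
  apply/matrixP => s t; rewrite !mxE big_ord1 !mxE !mxtens_indexK /= conjC_nat.
  by rewrite -natrM mulnb.
have [Q QE] := psd_factor (cpPhi _ _ (psd_gram v)).
have PhiE s i t j : Phi (delta_mx i j) s t =
    (Q *m Q^t*) (mxtens_index (s, i)) (mxtens_index (t, j)).
  by rewrite -QE extidE blk.
have KE := kraus_of_choi PhiE.
by eexists; eexists; split; [exact: KE | exact: kraus_trace KE trPhi].
Qed.

Lemma mxtrace_block a r (X : 'M[C]_(a * r)) : \tr X = \sum_i \tr (mxblockR X i i).
Proof.
rewrite /mxtrace exchange_big /= -sum_mxtens; apply: eq_bigr => x _.
by rewrite mxE -[(_, _)]/(mxtens_unindex x) mxtens_unindexK.
Qed.

Lemma maxentE d : maxent R d = maxent_vec C d *m (maxent_vec C d)^t*.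
Proof.
apply/matrixP => x y; rewrite -(mxtens_unindexK x) -(mxtens_unindexK y).
case: (mxtens_unindex x) (mxtens_unindex y) => s i [t j].
rewrite [RHS]mxE big_ord1 !mxE !mxtens_indexK /= rmorphM fmorphV /= sqrtC_nat conjC_nat.
rewrite mulrACA -invfM -expr2 sqrtCK mulrC; congr (_ * _).
rewrite summxE (bigD1 s) //= [X in _ + X]big1 ?addr0 => [|k ks]; rewrite summxE; last first.
  by apply: big1 => l _; rewrite tensmxE !mxE eq_sym (negPf ks) mul0r.
rewrite (bigD1 t) //= big1 ?addr0 => [|k kt]; rewrite tensmxE !mxE.
  by rewrite !eqxx mul1r -natrM mulnb [i == _]eq_sym [j == _]eq_sym.
by rewrite [t == _]eq_sym (negPf kt) andbF mul0r.
Qed.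

Lemma mxblockR_maxent d i j : mxblockR (maxent R d) i j = d%:R^-1 *: delta_mx i j.
Proof.
apply/matrixP => s t; rewrite maxentE !mxE big_ord1 !mxE !mxtens_indexK /=.
rewrite rmorphM fmorphV /= sqrtC_nat conjC_nat.
by rewrite mulrACA -invfM -expr2 sqrtCK mulrC -natrM mulnb.
Qed.

(** A single [tau] serves all gates [P f] and the decoder is arbitrary, so that infima over states
    and decoders can be taken afterwards. *)
Lemma twirl_deviation (I : finType) d p b e r (V : 'M[C]_(p, d)) (K : 'I_e -> 'M[C]_(b, p))
    (P : I -> 'M[C]_d) (N : 'M[C]_p -> 'M[C]_b) (Enc : 'M[C]_d -> 'M[C]_p)
    (Dec : {linear 'M[C]_b -> 'M[C]_d}) (psi : 'M[C]_(d * r)) :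
  d != 0%N -> V^t* *m V = 1%:M -> \sum_i (K i)^t* *m K i = 1%:M ->
  (forall f, (P f)^t* *m P f = 1%:M) -> twirl_to_trace P ->
  channel Dec -> density psi -> kraus_rep K N -> (forall X, Enc X = V *m X *m V^t*) ->
  exists2 tau : 'M[C]_e, density tau &
    \sum_f trnorm (extid (compl_channel K)
        (extid (fun X => V *m P f *m X *m (V *m P f)^t*) psi) - tau *t ptrace1 psi) <=
      2 * (#|I|%:R * purified_distance (maxent R d) (extid (Dec \o N \o Enc) (maxent R d))).
Proof.
move=> d0 V1 K1 P1 PT /channel_kraus[q [D [DE D1]]] [psi_psd psi1] NE EncE.
pose W i := K i *m V.
have W1 : \sum_i (W i)^t* *m W i = 1%:M.
  transitivity (V^t* *m (\sum_i (K i)^t* *m K i) *m V); last by rewrite K1 mulmx1.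
  rewrite mulmx_sumr mulmx_suml; apply: eq_bigr => i _.
  by rewrite /W adjmxM !mulmxA.
(* With no pair of Kraus indices every [W i] would be 0, contradicting [W1] in positive
   dimension. *)
have [z0 _|noz] := pickP (fun z : 'I_q * 'I_e => true); last first.
  have := W1; rewrite big1 => [/matrixP H|i _]; last first.
    rewrite -[W i]mul1mx -D1 big1 ?mul0mx ?mulmx0 // => k _.
    by have := noz (k, i).
  have d_gt0 : (0 < d)%N by rewrite lt0n.
  have := H (Ordinal d_gt0) (Ordinal d_gt0); rewrite !mxE eqxx => /esym/eqP.
  by rewrite oner_eq0.
pose c z := \tr (D z.1 *m W z.2) / d%:R.
have [chi chi1 chic] := unit_vector_aligned z0 c.
pose tau : 'M[C]_e := \matrix_(i, j) \sum_k chi (k, i) * (chi (k, j))^*.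
have tau_density : density tau.
  split; last first.
    rewrite -chi1 sum_pairE exchange_big; apply: eq_bigr => i _.
    by rewrite mxE.
  have -> : tau = (\matrix_(i, k) chi (k, i)) *m (\matrix_(i, k) chi (k, i))^t*.
    by apply/matrixP => i j; rewrite !mxE; apply: eq_bigr => k _; rewrite !mxE.
  exact: psd_gram.
exists tau => //.
have [Q QE] := psd_factor psi_psd.
pose Y x : 'M[C]_(d, d * r) := \matrix_(l, m) Q (mxtens_index (l, x)) m.
have blk x y : mxblockR psi x y = Y x *m (Y y)^t*.
  by apply/matrixP => s t; rewrite QE !mxE; apply: eq_bigr => m _; rewrite !mxE.
have Y1 : \sum_x \tr ((Y x)^t* *m Y x) = 1.
  rewrite -psi1 mxtrace_block; apply: eq_bigr => x _.
  by rewrite blk mxtrace_mulC.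
pose out f := extid (compl_channel K) (extid (fun X => V *m P f *m X *m (V *m P f)^t*) psi).
have outE f : out f = \sum_k grammx (output_family D W P Y (f, k)).
  apply/matrixP => x y; rewrite sum_grammx_output //.
  rewrite -[in LHS](mxtens_unindexK x) -[in LHS](mxtens_unindexK y).
  case: (mxtens_unindex x) (mxtens_unindex y) => i u [j v] /=.
  by rewrite extidE mxE mxblockR_extid blk /W !adjmxM !mulmxA.
have tgtE f : tau *t ptrace1 psi = \sum_k grammx (target_family P Y chi (f, k)).
  apply/matrixP => x y; rewrite sum_grammx_target //.
  rewrite -[in LHS](mxtens_unindexK x) -[in LHS](mxtens_unindexK y).
  case: (mxtens_unindex x) (mxtens_unindex y) => i u [j v] /=.
  by rewrite tensmxE !mxE blk.
have /choice[M MP] : forall f, exists M : 'M[C]_(e * r),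
    contractive M /\ ((trnorm (out f - tau *t ptrace1 psi))%:C)%C =
      \tr (M *m (out f - tau *t ptrace1 psi)).
  by move=> f; have [M Mc ME] := trnorm_dual (out f - tau *t ptrace1 psi); exists M.
have cc0 : 0 <= \sum_z c z * (c z)^* by apply: sumr_ge0 => z _; exact: mul_conjC_ge0.
have F0 : 0 <= \sum_z (chi z)^* * c z by rewrite chic sqrtC_ge0.
pose F := complex.Re (\sum_z (chi z)^* * c z).
have FE : \sum_z (chi z)^* * c z = (F%:C)%C by rewrite ge0_complexRe.
have F_ge0 : 0 <= F by rewrite -ler0c -FE.
pose S := \sum_f trnorm (out f - tau *t ptrace1 psi); rewrite -/S.
have S0 : 0 <= S by apply: sumr_ge0 => f _; exact: trnorm_ge0.
(* The weighted bound holds for every [t]; optimising it gives [2 |I| sqrt(1 - F^2)]. *)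
have SF : S <= 2 * Num.sqrt ((#|I|%:R * (1 - F)) * (#|I|%:R * (1 + F))).
  apply: le_sqrt_of_weighted_sum => // [|t t0].
    by rewrite mulr_ge0 // addr_ge0.
  have := @sum_Re_tr_twirl_le _ _ _ _ _ _ _ _ D W P Y D1 W1 P1 PT d0 Y1 chi chi1 M (t%:C)%C.
  have Mc f : contractive (M f) by case: (MP f).
  have t0' : 0 < (t%:C)%C :> C by rewrite -[0]/((0%:C)%C) ltcR.
  have FR : (\sum_z (chi z)^* * c z)^* = \sum_z (chi z)^* * c z.
    by rewrite conj_Creal // ger0_real.
  move=> /(_ Mc t0' FR); rewrite FE.
  have -> : \sum_f \tr (M f *m \sum_k (grammx (output_family D W P Y (f, k)) -
      grammx (target_family P Y chi (f, k)))) = (S%:C)%C.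
    rewrite rmorph_sum; apply: eq_bigr => f _; have [_ MfE] := MP f.
    by rewrite sumrB -outE -tgtE -MfE.
  rewrite -complexRe /= => H; rewrite -lecR; apply: le_trans H _.
  rewrite le_eqVlt; apply/orP; left; apply/eqP.
  rewrite -(rmorph_nat (real_complex R)) -(rmorph1 (real_complex R)) -fmorphV.
  by rewrite -rmorphB -rmorphD -!rmorphM -rmorphD -rmorphM; congr (_%:C)%C; ring.
apply: le_trans SF _; rewrite ler_pM2l //.
rewrite mulrACA -expr2 sqrtrM ?sqr_ge0 // sqrtr_sqr ger0_norm //.
rewrite ler_wpM2l //; apply: ler_wsqrtr.
have -> : (1 - F) * (1 + F) = 1 - F ^+ 2 by ring.
(* It remains to see that the fidelity is at most [F], the square root of the entanglement
   fidelity. *)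
rewrite lerD2l lerN2.
set sigma := extid _ _.
have sigmaE s i t j : sigma (mxtens_index (s, i)) (mxtens_index (t, j)) =
     \sum_z d%:R^-1 * ((D z.1 *m W z.2) s i * ((D z.1 *m W z.2) t j)^*).
  rewrite /sigma extidE mxblockR_maxent.
  have OpE X : (Dec \o N \o Enc) X = \sum_z (D z.1 *m W z.2) *m X *m (D z.1 *m W z.2)^t*.
    transitivity (\sum_k \sum_i D k *m W i *m X *m (D k *m W i)^t*); last first.
      by rewrite pair_bigA.
    rewrite /= DE NE EncE; apply: eq_bigr => k _.
    rewrite mulmx_sumr mulmx_suml; apply: eq_bigr => l _.
    by rewrite /W !adjmxM !mulmxA.
  by rewrite OpE summxE; apply: eq_bigr => z _; rewrite conj_scale_delta_mx.
have [sigma_psd sigmaF] := maxent_overlap sigmaE.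
have F2 : \sum_z c z * (c z)^* = ((F ^+ 2)%:C)%C.
  by rewrite rmorphXn /= -FE chic sqrtCK.
have fid0 : 0 <= fidelity (maxent R d) sigma by exact: trnorm_ge0.
rewrite ler_sqr ?nnegrE //.
have [M' Mc' ME'] := trnorm_dual (sqrtmx (maxent R d) *m sqrtmx sigma).
(* Written in this form to match the weighted bound with [a = F^2 / 2] and [b = 1 / 2]. *)
have -> : F = 2 * Num.sqrt ((F ^+ 2 / 2) * 2^-1).
  rewrite -mulrA -invfM sqrtrM ?sqr_ge0 // sqrtr_sqr ger0_norm //.
  have -> : (2 * 2 : R)^-1 = (2^-1) ^+ 2 by field.
  by rewrite sqrtr_sqr ger0_norm ?invr_ge0 //; field.
apply: le_sqrt_of_weighted_sum => // t t0.
have t0' : 0 < (t%:C)%C :> C by rewrite -[0]/((0%:C)%C) ltcR.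
have := pure_fidelity_le (maxent_vec_unit C d0) sigma_psd Mc' t0'.
rewrite -maxentE -!sqrtmxE -ME' sigmaF F2 -complexRe /= => H.
rewrite -lecR; apply: le_trans H _.
rewrite le_eqVlt; apply/orP; left; apply/eqP.
rewrite -(rmorph_nat (real_complex R)) -!fmorphV -!rmorphM -rmorphD -rmorphM.
by congr (_%:C)%C; ring.
Qed.

End Bridge.

(** * Pauli gates on a register *)

Section Paulis.
Variable R : realType.
Local Notation C := R[i].

(** The bits are the exponents of X and Z, up to phase; this indexes the gates by a finite type over
    which sums can be taken. *)
Definition pauli_of (z : bool * bool) : pauli :=
  match z with
  | (false, false) => PauliI
  | (false, true) => PauliZ
  | (true, false) => PauliX
  | (true, true) => PauliY
  end.

Lemma conj_imag : (('i%C : C)^* = - 'i%C) * ('i%C * 'i%C = -1 :> C).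
Proof. by split; rewrite complexiE ?conjCi // -expr2 sqrCi. Qed.

Lemma pauli1_unitary p s t :
  \sum_(u : bool) (pauli1 R p u s)^* * pauli1 R p u t = (s == t)%:R.
Proof.
by rewrite big_bool; case: p s t => [] [] [] //=; rewrite ?rmorphN /= ;
  rewrite ?(conj_imag, conjC0, conjC1, expr0, expr1, mul0r, mulr0, addr0, add0r, mulr1, mul1r,
    mulNr, mulrN);
  rewrite ?(opprK, oppr0, subrr, addNr) //.
Qed.

(** Completeness of the four gates as an orthogonal basis of the 2 by 2 matrices, checked entry by
    entry. *)
Lemma pauli1_twirl u v s t :
  \sum_(z : bool * bool) (pauli1 R (pauli_of z) u s)^* * pauli1 R (pauli_of z) v t =
  2 * ((u == v) && (s == t))%:R.
Proof.
by rewrite sum_pairE !big_bool /=; case: u v s t => [] [] [] [] //=; rewrite ?rmorphN /= ;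
  rewrite ?(conj_imag, conjC0, conjC1, expr0, expr1, mul0r, mulr0, addr0, add0r, mulr1, mul1r,
    mulNr, mulrN);
  rewrite ?(opprK, oppr0, subrr, addNr) //.
Qed.

Variable I : finType.

(** The gates [paulimx] for any set of labels, so that they also act on the logical register. *)
Definition regpauli (p : I -> pauli) : 'M[C]_(qdim I) :=
  \matrix_(s, t) \prod_q pauli1 R (p q) (qbits s q) (qbits t q).

Lemma sum_qbits (F : {ffun I -> bool} -> C) : \sum_(s < qdim I) F (qbits s) = \sum_x F x.
Proof. by rewrite /qdim -(big_enum_val (A := qbasis I) F); apply: eq_bigl. Qed.

Lemma prod_natr_forall (b : I -> bool) : \prod_q ((b q)%:R : C) = [forall q, b q]%:R.
Proof.
case: forallP => [H|H]; first by rewrite big1 // => q _; rewrite H.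
have /existsP[q /negPf bq] : [exists q, ~~ b q] by rewrite -negb_forall; apply/forallP.
by rewrite (bigD1 q) //= bq mul0r.
Qed.

Lemma eq_qbits (s t : 'I_(qdim I)) : [forall q, qbits s q == qbits t q] = (s == t).
Proof.
apply/forallP/eqP => [H|-> //]; apply: enum_val_inj; apply/ffunP => q; exact/eqP.
Qed.

Lemma regpauli_unitary p : (regpauli p)^t* *m regpauli p = 1%:M.
Proof.
apply/matrixP => s t; rewrite mxE.
transitivity (\sum_(u < qdim I) \prod_q ((pauli1 R (p q) (qbits u q) (qbits s q))^* *
    pauli1 R (p q) (qbits u q) (qbits t q))).
  by apply: eq_bigr => u _; rewrite !mxE rmorph_prod -big_split.
rewrite (sum_qbits (fun x => \prod_q ((pauli1 R (p q) (x q) (qbits s q))^* *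
    pauli1 R (p q) (x q) (qbits t q)))).
rewrite -(bigA_distr_bigA (fun q b =>
    (pauli1 R (p q) b (qbits s q))^* * pauli1 R (p q) b (qbits t q))).
under eq_bigr do rewrite pauli1_unitary.
by rewrite prod_natr_forall eq_qbits mxE.
Qed.

Lemma card_qdim : qdim I = (2 ^ #|I|)%N.
Proof. by rewrite /qdim /qbasis card_ffun card_bool. Qed.

Lemma regpauli_twirl :
  twirl_to_trace (fun f : {ffun I -> bool * bool} => regpauli (pauli_of \o f)).
Proof.
have H u v s t : \sum_(f : {ffun I -> bool * bool})
    (regpauli (pauli_of \o f) u s)^* * regpauli (pauli_of \o f) v t =
    (2 ^ #|I|)%:R * ((u == v) && (s == t))%:R.
  transitivity (\sum_(f : {ffun I -> bool * bool}) \prod_q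
      ((pauli1 R (pauli_of (f q)) (qbits u q) (qbits s q))^* *
       pauli1 R (pauli_of (f q)) (qbits v q) (qbits t q))).
    by apply: eq_bigr => f _; rewrite !mxE rmorph_prod -big_split.
  (* The sum over all gates factors into one-qubit sums, each contributing a factor 2. *)
  rewrite -(bigA_distr_bigA (fun q z =>
       (pauli1 R (pauli_of z) (qbits u q) (qbits s q))^* *
       pauli1 R (pauli_of z) (qbits v q) (qbits t q))).
  under eq_bigr do rewrite pauli1_twirl.
  rewrite big_split /= prodr_const natrX prod_natr_forall; congr (_ * (_ : bool)%:R).
  rewrite -!eq_qbits; apply/forallP/andP => [H|[/forallP H1 /forallP H2] q]; last by rewrite H1 H2.
  by split; apply/forallP => q; have /andP[] := H q.
move=> G; apply/matrixP => s t; rewrite mxE summxE.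
transitivity ((qdim I)%:R * \sum_u \sum_v G u v * \sum_(f : {ffun I -> bool * bool})
    (regpauli (pauli_of \o f) u s)^* * regpauli (pauli_of \o f) v t).
  congr (_ * _).
  transitivity (\sum_(f : {ffun I -> bool * bool}) \sum_u \sum_v G u v *
    ((regpauli (pauli_of \o f) u s)^* * regpauli (pauli_of \o f) v t)).
    apply: eq_bigr => f _; rewrite exchange_big mxE; apply: eq_bigr => v _.
    rewrite mxE mulr_suml; apply: eq_bigr => u _.
    by rewrite [(_^t*) _ _]mxE [(_^T) _ _]mxE; ring.
  rewrite exchange_big; apply: eq_bigr => u _; rewrite exchange_big; apply: eq_bigr => v _.
  by rewrite mulr_sumr.
rewrite card_ffun card_prod card_bool mxE /mxtrace.
have -> : \sum_u \sum_v G u v * \sum_(f : {ffun I -> bool * bool})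
    (regpauli (pauli_of \o f) u s)^* * regpauli (pauli_of \o f) v t =
    \sum_u G u u * ((2 ^ #|I|)%:R * (s == t)%:R).
  apply: eq_bigr => u _; rewrite (bigD1 u) //= [X in _ + X]big1 ?addr0 => [|v vu]; rewrite H.
    by rewrite eqxx.
  by rewrite eq_sym (negPf vu) /= mulr0 mulr0.
have -> : (qdim I)%:R = (2 ^ #|I|)%:R :> C by rewrite card_qdim.
by rewrite -mulr_suml expnMn natrM -mulr_natr; ring.
Qed.

End Paulis.

(** * Logical gates and the encoding isometry *)

Section Logical.
Variables (R : realType) (n : nat) (L : {set 'I_n}).
Local Notation C := R[i].

(** Extension from [L] to all qubits by a default: [false] for the ancilla bits, [PauliI] for the
    gates. *)
Definition pad (T : Type) (x0 : T) (x : inL L -> T) (q : 'I_n) : T :=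
  if insub q is Some u then x u else x0.

Lemma pad_in T (x0 : T) x (u : inL L) : pad x0 x (val u) = x u.
Proof. by rewrite /pad valK. Qed.

Lemma pad_out T (x0 : T) x q : q \notin L -> pad x0 x q = x0.
Proof. by move=> qL; rewrite /pad insubN. Qed.

Definition zero_pad (l : 'I_(qdim (inL L))) : 'I_(qdim 'I_n) :=
  qindex [ffun q => pad false (qbits l) q].

Lemma qbits_zero_pad l q : qbits (zero_pad l) q = pad false (qbits l) q.
Proof. by rewrite /qbits /zero_pad /qindex enum_rankK ffunE. Qed.

Lemma zero_pad_inj : injective zero_pad.
Proof.
move=> l l' H; apply: enum_val_inj; apply/ffunP => u.
by have := congr1 (fun s => qbits s (val u)) H; rewrite !qbits_zero_pad !pad_in.
Qed.

(* The isometry [|l> |-> |l> (x) |0>] from L to S. *)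
Definition inclmx : 'M[C]_(qdim 'I_n, qdim (inL L)) :=
  \matrix_(s, l) (s == zero_pad l)%:R.

Lemma inclmx_isometry : inclmx^t* *m inclmx = 1%:M.
Proof.
apply/matrixP => l l'; rewrite !mxE (bigD1 (zero_pad l)) //= big1 ?addr0.
  by rewrite !mxE eqxx conjC1 mul1r (inj_eq zero_pad_inj).
by move=> s /negPf sl; rewrite !mxE sl conjC0 mul0r.
Qed.

Lemma regmx_zero s (l : 'I_(qdim (inL L))) :
  regmx R L s (mxtens_index (l, qindex [ffun _ : notL L => false])) = inclmx s l.
Proof.
rewrite !mxE mxtens_indexK /=; congr ((_ : bool)%:R); rewrite /qbits /qindex enum_rankK.
apply/andP/eqP => [[/eqP H1 /eqP H2]|->].
  apply: enum_val_inj; apply/ffunP => q; rewrite -[RHS]/(qbits (zero_pad l) q) qbits_zero_pad.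
  rewrite /pad; case: insubP => [u qL <-|qL].
    by rewrite /qbits -H1 ffunE.
  by have /ffunP/(_ (Sub q qL)) := H2; rewrite !ffunE.
split; apply/eqP/ffunP => u; rewrite ffunE -[LHS]/(qbits (zero_pad l) _) qbits_zero_pad.
  exact: pad_in.
by rewrite pad_out ?ffunE //; exact: (valP u).
Qed.

Lemma encodingE U rho : encoding U rho = (U *m inclmx) *m rho *m (U *m inclmx)^t*.
Proof.
rewrite /encoding.
have -> : regmx R L *m (rho *t zero_state R L) *m (regmx R L)^t* = inclmx *m rho *m inclmx^t*.
  set z := qindex [ffun _ : notL L => false].
  (* The isometry appending the zero state, inside the tensor product. The nested adjoints below let
     the entry formula [TM] apply on both sides. *)
  pose T : 'M[C]_(_, qdim (inL L)) := \matrix_(x, l)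
    (((mxtens_unindex x).1 == l) && ((mxtens_unindex x).2 == z))%:R.
  have TM m (X : 'M[C]_(_, m)) x j :
      (T *m X) x j = ((mxtens_unindex x).2 == z)%:R * X (mxtens_unindex x).1 j.
    rewrite mxE (bigD1 (mxtens_unindex x).1) //= [X in _ + X]big1 ?addr0.
      by rewrite mxE eqxx.
    by move=> l /negPf lx; rewrite mxE eq_sym lx mul0r.
  have -> : rho *t zero_state R L = T *m (T *m rho^t*)^t*.
    apply/matrixP => x y; rewrite TM !(mxE, TM) rmorphM /= conjCK conjC_nat -/z.
    by rewrite -mulnb natrM; ring.
  have RT : regmx R L *m T = inclmx.
    apply/matrixP => s l; rewrite -regmx_zero -/z [LHS]mxE (bigD1 (mxtens_index (l, z))) //=.
    rewrite [X in _ + X]big1 ?addr0; first by rewrite [T _ _]mxE mxtens_indexK !eqxx mulr1.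
    move=> x /negPf xlz; rewrite [T _ _]mxE.
    case: andP => [[/eqP xl /eqP xz]|_]; last by rewrite mulr0.
    by move/negP: xlz; case; rewrite -xl -xz -surjective_pairing mxtens_unindexK.
  by rewrite -RT !adjmxM !trmxCK !mulmxA.
by rewrite !adjmxM !mulmxA.
Qed.

(** A logical gate before the encoding is a Pauli gate on all of S, trivial on the ancillas; this
    turns an average over logical gates into one over [U *m P]. *)
Lemma paulimx_inclmx (p : inL L -> pauli) :
  paulimx R (pad PauliI p) *m inclmx = inclmx *m regpauli R p.
Proof.
apply/matrixP => s l; rewrite !mxE (bigD1 (zero_pad l)) //= [X in _ + X]big1 ?addr0; last first.
  by move=> t /negPf tl; rewrite !mxE tl mulr0.
rewrite !mxE eqxx mulr1.
case: (pickP (fun l' => s == zero_pad l')) => [l' /eqP sl'|nol].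
  rewrite (bigD1 l') //= [X in _ + X]big1 ?addr0; last first.
    by move=> m ml; rewrite !mxE sl' (inj_eq zero_pad_inj) eq_sym (negPf ml) mul0r.
  rewrite !mxE sl' eqxx mul1r (bigID (mem L)) /= [X in _ * X]big1 ?mulr1; last first.
    by move=> q qL; rewrite !qbits_zero_pad !pad_out.
  rewrite big_sub; apply: eq_bigr => u _.
  by rewrite !qbits_zero_pad !pad_in.
rewrite [RHS]big1 => [|l' _]; last by rewrite !mxE nol mul0r.
(* A row outside the image of [zero_pad] has a bit set outside [L], where the identity factor of the
   gate vanishes. *)
have /existsP[q /andP[qL sq]] : [exists q, (q \notin L) && qbits s q].
  apply/contraT => /existsPn H.
  have := nol (qindex [ffun u : inL L => qbits s (val u)]); move/negP; case.
  apply/eqP/enum_val_inj/ffunP => q; rewrite -[RHS]/(qbits (zero_pad _) q) qbits_zero_pad.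
  rewrite /pad; case: insubP => [u qL <-|qL].
    by rewrite [in RHS]/qbits /qindex enum_rankK ffunE.
  by have := H q; rewrite qL => /negPf.
by rewrite (bigD1 q) //= qbits_zero_pad !pad_out // sq mul0r.
Qed.

End Logical.

(** * Pointwise bound for the averaged deviation *)

Section KrausChannel.
Variables (R : realType) (a b e : nat).
Local Notation C := R[i].
Variable K : 'I_e -> 'M[C]_(b, a).

Definition kraus_map (X : 'M[C]_a) : 'M[C]_b := \sum_i K i *m X *m (K i)^t*.

Lemma kraus_map_is_linear : linear kraus_map.
Proof.
move=> c X Y; rewrite /kraus_map scaler_sumr -big_split; apply: eq_bigr => i _ /=.
by rewrite mulmxDr mulmxDl -scalemxAr -scalemxAl.
Qed.

HB.instance Definition _ :=
  GRing.isLinear.Build C 'M[C]_a 'M[C]_b _ kraus_map kraus_map_is_linear.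

Lemma kraus_map_channel : \sum_i (K i)^t* *m K i = 1%:M -> channel kraus_map.
Proof.
move=> K1; split=> [X|r X /psd_factor[Q ->]].
  rewrite -[X in RHS]mul1mx -K1 /kraus_map mulmx_suml !raddf_sum; apply: eq_bigr => i _ /=.
  by rewrite mxtrace_mulC mulmxA.
pose Y x : 'M[C]_(a, a * r) := \matrix_(l, m) Q (mxtens_index (l, x)) m.
have blk x y : mxblockR (Q *m Q^t*) x y = Y x *m (Y y)^t*.
  by apply/matrixP => s t; rewrite !mxE; apply: eq_bigr => m _; rewrite !mxE.
(* One vector for each Kraus operator and each column of [Q]; their outer products sum to the image,
   which is therefore positive. *)
pose h (z : 'I_e * 'I_(a * r)) : 'cV[C]_(b * r) :=
  \col_x (K z.1 *m Y (mxtens_unindex x).2) (mxtens_unindex x).1 z.2.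
suff -> : extid kraus_map (Q *m Q^t*) = \sum_z h z *m (h z)^t* by exact: psd_sum_outer.
apply/matrixP => x y; rewrite -(mxtens_unindexK x) -(mxtens_unindexK y).
case: (mxtens_unindex x) (mxtens_unindex y) => s i [t j].
rewrite extidE blk /kraus_map !summxE.
transitivity (\sum_k \sum_m (h (k, m) *m (h (k, m))^t*)
    (mxtens_index (s, i)) (mxtens_index (t, j))).
  2: by rewrite pair_bigA; apply: eq_bigr => -[].
apply: eq_bigr => k _.
rewrite mulmxA -[_ *m (Y j)^t* *m _]mulmxA -adjmxM mxE; apply: eq_bigr => m _.
by rewrite [RHS]mxE big_ord1 !mxE !mxtens_indexK.
Qed.

End KrausChannel.

Section Pointwise.
Variables (R : realType) (n : nat) (L : {set 'I_n}).
Local Notation C := R[i].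

Lemma qdim_gt0 (I : finType) : (0 < qdim I)%N.
Proof. by rewrite card_qdim expn_gt0. Qed.

(** The channel [X |-> tr(X) |z><z|]. It shows that the set of decoders is nonempty, so its infimum
    is a genuine one. *)
Lemma channel_exists a b : (0 < b)%N -> exists D : {linear 'M[C]_a -> 'M[C]_b}, channel D.
Proof.
move=> b0; pose z := Ordinal b0.
exists (kraus_map (fun k : 'I_a => delta_mx z k : 'M[C]_(b, a))).
apply: kraus_map_channel.
rewrite [RHS]mx1_sum_delta; apply: eq_bigr => k _.
by rewrite trmx_delta map_delta_mx mul_delta_mx.
Qed.

Definition logical_pauli (f : {ffun inL L -> bool * bool}) : 'I_n -> pauli :=
  pad PauliI (pauli_of \o f).

Lemma env_deviation_ge0 e r (K : 'I_e -> 'M[C]_(qdim 'I_n)) (psi : 'M[C]_(qdim (inL L) * r)) U :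
  0 <= env_deviation K psi U.
Proof.
rewrite /env_deviation; set S := [set _ | _ in _].
(* For [e = 0] there is no state, and the infimum of the empty set is 0 by convention. *)
have [->|/set0P S0] := eqVneq S set0; first by rewrite inf0.
by apply: lb_le_inf => // _ [tau _ <-]; exact: trnorm_ge0.
Qed.

Lemma sum_env_deviation_le e r (K : 'I_e -> 'M[C]_(qdim 'I_n))
    (N : {linear 'M[C]_(qdim 'I_n) -> 'M[C]_(qdim 'I_n)})
    (psi : 'M[C]_(qdim (inL L) * r)) (U : 'M[C]_(qdim 'I_n)) :
  channel N -> kraus_rep K N -> density psi -> U \is unitarymx ->
  \sum_f env_deviation K psi (U *m paulimx R (logical_pauli f)) <=
    2 * (#|{ffun inL L -> bool * bool}|%:R * choi_error L N U).
Proof.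
move=> [trN _] hK hpsi /unitarymxP/mulmx1C U1.
set c := #|_|%:R.
have c0 : 0 < c.
  by rewrite ltr0n card_ffun expn_gt0 card_prod card_bool.
have c20 : 0 < 2 * c by rewrite mulr_gt0.
(* Isolating the infimum over decoders reduces the claim to a bound for each fixed decoder. *)
rewrite mulrA [2 * _ * _]mulrC -ler_pdivrMr //.
apply: lb_le_inf.
  have [D hD] := channel_exists (qdim 'I_n) (qdim_gt0 (inL L)).
  by eexists; exists D.
move=> _ [D hD <-]; rewrite ler_pdivrMr // [_ * (2 * _)]mulrC -mulrA.
have V1 : (U *m inclmx R L)^t* *m (U *m inclmx R L) = 1%:M.
  by rewrite adjmxM mulmxA -[_ *m _ *m U]mulmxA U1 mulmx1 inclmx_isometry.
have K1 := kraus_trace hK trN.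
have d0 : qdim (inL L) != 0%N by rewrite -lt0n qdim_gt0.
have [tau htau] := twirl_deviation d0 V1 K1
  (fun f : {ffun inL L -> bool * bool} => regpauli_unitary R (pauli_of \o f))
  (@regpauli_twirl R (inL L)) hD hpsi hK (encodingE U).
apply: le_trans; apply: ler_sum => f _.
(* The common [tau] is a candidate in the infimum of every gate. *)
apply: ge_inf; first by exists 0 => _ [t _ <-]; exact: trnorm_ge0.
have EncE : encoding (U *m paulimx R (logical_pauli f)) =
    fun X => U *m inclmx R L *m regpauli R (pauli_of \o f) *m X *m
             (U *m inclmx R L *m regpauli R (pauli_of \o f))^t*.
  have VE : U *m paulimx R (logical_pauli f) *m inclmx R L =
      U *m inclmx R L *m regpauli R (pauli_of \o f).
    by rewrite -mulmxA paulimx_inclmx mulmxA.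
  by apply/funext => X; rewrite encodingE VE.
by exists tau; [exact: htau | rewrite EncE].
Qed.

End Pointwise.

(** * Averaging over the ensemble *)

Lemma continuous_mulmxr (K : numFieldType) m n p (P : 'M[K^o]_(n, p)) :
  continuous (fun U : 'M[K^o]_(m, n) => (U *m P : 'M[K^o]_(m, p))).
Proof.
move=> U A [B nB BA]; apply: (@filterS _ _ _ [set V : 'M[K^o]_(m, n) |
   forall i j, B i j ((V *m P) i j)]).
  by move=> V /= HV; apply: BA.
have FU : Filter (nbhs U) := nbhs_filter U.
apply: (@filter_forall _ _ (fun i (V : 'M[K^o]_(m, n)) => forall j, B i j ((V *m P) i j))
  (nbhs U) FU) => i.
apply: (@filter_forall _ _ (fun j (V : 'M[K^o]_(m, n)) => B i j ((V *m P) i j))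
  (nbhs U) FU) => j.
have : (fun V : 'M[K^o]_(m, n) => (V *m P) i j) @ U --> ((U *m P) i j : K^o).
  rewrite mxE (_ : (fun V => _) = (fun V : 'M[K^o]_(m, n) => \sum_k (V i k : K^o) * (P k j : K^o))).
    apply: (@cvg_big K^o 'I_n +%R 0 xpredT (@add_continuous K^o) 'M[K^o]_(m, n) (nbhs U)
      (index_enum _) (fun k V => (V i k : K^o) * (P k j : K^o))
      (fun k => (U i k : K^o) * (P k j : K^o)) FU) => k _.
    apply: (@cvgMr_tmp K 'M[K^o]_(m, n) (nbhs U) FU); exact: coord_continuous.
  by apply/funext => V; rewrite mxE.
by apply; exact: nB.
Qed.

Section Invariance.
Variables (R : realType) (n : nat).
Local Notation C := R[i].
Local Notation T := (mxBorel R (qdim 'I_n)).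

Lemma paulimx_unitary p : (paulimx R p : 'M[C]_(qdim 'I_n)) \is unitarymx.
Proof. by apply/unitarymxP/mulmx1C; exact: regpauli_unitary. Qed.

Definition rmul_pauli p (U : T) : T := (U : 'M[C]_(qdim 'I_n)) *m paulimx R p.

Lemma unitaries_rmul_pauli p (U : T) :
  @unitaries R (qdim 'I_n) (rmul_pauli p U) <-> @unitaries R (qdim 'I_n) U.
Proof.
by split; rewrite /unitaries /rmul_pauli /= (unitarymx_mulr _ (paulimx_unitary p)).
Qed.

Lemma measurable_rmul_pauli p : measurable_fun setT (rmul_pauli p).
Proof.
apply: (@measurability _ _ T T setT (rmul_pauli p) (@open 'M[C^o]_(qdim 'I_n))) => // _ [A oA <-].
rewrite setTI; apply: sub_sigma_algebra.
have := @continuous_mulmxr C (qdim 'I_n) _ _ (paulimx R p).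
by move=> /continuousP; apply.
Qed.

Variable mu : probability (mxBorel R (qdim 'I_n)) R.
Hypothesis hinv : pauli_right_invariant mu.

(** Invariance is stated for images and a pushforward needs preimages; it is applied to the
    preimage, whose image is [A] because the map is onto. *)
Lemma rmul_pauli_preserves p (A : set T) : measurable A ->
  mu (rmul_pauli p @^-1` A) = mu A.
Proof.
move=> mA; rewrite (hinv p); last first.
  by rewrite -[X in measurable X]setTI; exact: measurable_rmul_pauli.
congr (mu _); apply/seteqP; split=> [_ [U AU <-] //|U AU].
have /unitarymxP PP := paulimx_unitary p.
have PP' := mulmx1C PP.
exists ((U : 'M[C]_(qdim 'I_n)) *m (paulimx R p)^t*).
  by rewrite /rmul_pauli /= -mulmxA PP' mulmx1.
by rewrite -mulmxA PP' mulmx1.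
Qed.

Lemma integral_rmul_pauli p (f : T -> \bar R) : measurable_fun setT f ->
  (forall U, (0 <= f U)%E) ->
  (\int[mu]_U f (rmul_pauli p U) = \int[mu]_U f U)%E.
Proof.
move=> mf f0.
have := @ge0_integral_pushforward _ _ _ _ R _ (measurable_rmul_pauli p) mu setT f
  measurableT mf (fun y _ => f0 y).
rewrite preimage_setT => <-; apply: eq_measure_integral => [|mT A mA _].
  exact: measurable_rmul_pauli.
exact: rmul_pauli_preserves.
Qed.

End Invariance.

(** A simple function below [f] is also below [g], and each integral is the supremum over such
    functions, measurable integrand or not. *)
Lemma le_integral_nonneg d (T : measurableType d) (R : realType)
    (mu : {measure set T -> \bar R}) (f g : T -> \bar R) :
  (forall x, 0 <= f x)%E -> (forall x, f x <= g x)%E ->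
  (\int[mu]_x f x <= \int[mu]_x g x)%E.
Proof.
move=> f0 fg; have g0 x : (0 <= g x)%E := le_trans (f0 x) (fg x).
rewrite !ge0_integralTE //; apply: le_ereal_sup => _ [h hf <-].
by exists h => // x; exact: le_trans (hf x) (fg x).
Qed.

Import HBNNSimple.

(* [f] and [g] need not be measurable: the integral of a nonnegative function is
   the supremum of the integrals of the simple functions below it, so it is
   enough to average a simple [h <= f] over the maps [s i]. *)
Lemma le_lower_integral_of_average d (T : measurableType d) (R : realType)
    (mu : {measure set T -> \bar R}) (I : finType) (s : I -> T -> T)
    (f g : T -> \bar R) (c : R) :
  0 < c -> (forall x, 0 <= f x)%E ->
  (forall i, measurable_fun setT (s i)) ->
  (forall i h, measurable_fun setT h -> (forall x, 0 <= h x)%E ->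
     \int[mu]_x h (s i x) = \int[mu]_x h x)%E ->
  (forall x, \sum_i f (s i x) <= (c * #|I|%:R)%:E * g x)%E ->
  (0 < #|I|)%N ->
  (\int[mu]_x f x <= c%:E * \int[mu]_x g x)%E.
Proof.
move=> c0 f0 ms inv fg I0.
rewrite (ge0_integralTE _ f0); apply: ge_ereal_sup => _ [h hf <-].
rewrite -integralT_nnsfun.
have cI : (0 < c * #|I|%:R)%R by rewrite mulr_gt0 // ltr0n.
have mh : measurable_fun setT (EFin \o h) by exact: measurableT_comp.
have h0 x : (0 <= (h x)%:E)%E by rewrite lee_fin.
(* The average of [h] over the maps, divided by [c]: invariance gives [c] times its integral equal
   to that of [h], and the hypothesis on [f] puts it below [g]. *)
pose k x := ((c * #|I|%:R)^-1%:E * \sum_i (h (s i x))%:E)%E.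
have mhs i : measurable_fun setT (fun x => (h (s i x))%:E).
  exact: (measurableT_comp mh).
have -> : (\int[mu]_x (h x)%:E = c%:E * \int[mu]_x k x)%E.
  rewrite ge0_integralZl_EFin //; first last.
  - by rewrite invr_ge0 ltW.
  - exact: emeasurable_sum.
  - by move=> x _; apply: sume_ge0 => i _.
  rewrite ge0_integral_sum //.
  rewrite (eq_bigr (fun=> \int[mu]_x (h x)%:E)%E) => [|i _]; last first.
    exact: (inv i (EFin \o h) mh h0).
  set J := (\int[mu]_x _)%E.
  have -> : (\sum_(i : I) J = #|I|%:R%:E * J)%E.
    rewrite (_ : #|I|%:R%:E = \sum_(i : I) 1%:E)%E; last by rewrite sumEFin sumr_const.
    by rewrite ge0_sume_distrl //; apply: eq_bigr => i _; rewrite mul1e.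
  rewrite muleA -EFinM muleA -EFinM -mulrA mulrCA -[c * _]mulrC.
  by rewrite mulVf ?mul1e // mulrC gt_eqF.
rewrite lee_pmul2l //; apply: le_integral_nonneg => x.
  by apply: mule_ge0; [rewrite lee_fin invr_ge0 ltW | apply: sume_ge0 => i _].
rewrite /k -(@lee_pmul2l _ (c * #|I|%:R)%:E) ?lte_fin // muleA -EFinM divff ?gt_eqF // mul1e.
by apply: le_trans (fg x); apply: lee_sum => i _; exact: hf.
Qed.

Theorem proposition2 (R : realType) (n k : nat) (L : {set 'I_n})
  (hL : #|L| = k)
  (mu : probability (mxBorel R (qdim 'I_n)) R)
  (hmu : unitary_ensemble mu)
  (hinv : pauli_right_invariant mu)
  (N : {linear 'M[R[i]]_(qdim 'I_n) -> 'M[R[i]]_(qdim 'I_n)})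
  (hN : channel N)
  (e : nat) (K : 'I_e -> 'M[R[i]]_(qdim 'I_n))
  (hK : kraus_rep K N)
  (r : nat) (psi : 'M[R[i]]_(qdim (inL L) * r))
  (hpsi : density psi) :
  (ensemble_mean mu (env_deviation K psi) <= 2%:E * ensemble_mean mu (choi_error L N))%E.
Proof.
(* Both integrands are extended by 0 off the unitary group, a set stable under right multiplication
   by Pauli gates. *)
rewrite /ensemble_mean integral_mkcond [in leRHS]integral_mkcond.
apply: (le_lower_integral_of_average
    (s := fun f : {ffun inL L -> bool * bool} => @rmul_pauli R n (logical_pauli f))).
- exact: ltr0n.
- by move=> U; apply: erestrict_ge0 => V _; rewrite lee_fin env_deviation_ge0.
- by move=> f; exact: measurable_rmul_pauli.
- by move=> f h mh h0; exact: integral_rmul_pauli.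
- move=> U.
  have rmulU (f : {ffun inL L -> bool * bool}) :
      (rmul_pauli (logical_pauli f) U \in @unitaries R (qdim 'I_n)) =
      (U \in @unitaries R (qdim 'I_n)).
    by apply/idP/idP => /set_mem/unitaries_rmul_pauli/mem_set.
  rewrite patchE; under eq_bigr do rewrite patchE rmulU.
  case: ifPn => [|] UU; last by rewrite mule0 big1.
  rewrite sumEFin -EFinM lee_fin -mulrA; apply: sum_env_deviation_le => //.
  by move: UU; rewrite inE.
- by rewrite card_ffun expn_gt0 card_prod card_bool.
Qed.
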